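(* Let $G$ be a continuous family groupoid and let $(Y,p)$ be a $G$-space. Then the continuous family $G*Y=(G,s)*(Y,p)=\{(g,y)\in G\times Y: s(g)=p(y)\}$, with its groupoid operations and with the continuous family structures on $(G*Y,s)$ and $(G*Y,r)$ described in the context, is a continuous family groupoid.
   Context: **$C^{0,\infty}$ maps.** Let $k\ge 1$. For open $V_1,V_2\subset\mathbb{R}^k$, $C^\infty(V_1,V_2)$ carries the topology of uniform convergence on compact subsets of $V_1$ for all derivatives. Let $Y$ be a topological space and $q_1:Y\times\mathbb{R}^k\to Y$ the projection. Let $A_1,A_2\subset Y\times\mathbb{R}^k$ be open with $q_1(A_1)\subset q_1(A_2)$, and let $A_i^y=\{x\in\mathbb{R}^k:(y,x)\in A_i\}$. A continuous map $f:A_1\to A_2$ is fiber preserving if $f(\{y\}\times A_1^y)\subset\{y\}\times A_2^y$ for all $y\in q_1(A_1)$; then $f^y:A_1^y\to A_2^y$ is defined by $f(y,x)=(y,f^y(x))$. Such an $f$ belongs to $C^{0,\infty}(A_1,A_2)$ if, whenever $U_i\subset Y$, $V_i\subset\mathbb{R}^k$ are open with $U_i\times V_i\subset A_i$ ($i=1,2$) and $f(U_1\times V_1)\subset U_2\times V_2$, the map $y\mapsto f^y|_{V_1}$ is continuous from $U_1$ into $C^\infty(V_1,V_2)$. $\mathrm{Diff}^0(A_1,A_2)$ is the set of $f\in C^{0,\infty}(A_1,A_2)$ for which $f^{-1}$ exists and belongs to $C^{0,\infty}(A_2,A_1)$. **Continuous families.** A fiber space $(X,p)$ over $Y$ consists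 of locally compact Hausdorff spaces $X,Y$ and a continuous open surjection $p:X\to Y$; write $X^y=p^{-1}(\{y\})$. A continuous family (of manifolds) over $Y$ is a fiber space $(X,p)$ over $Y$ with a (maximal) atlas of charts $(U_\alpha,\phi_\alpha)$, where the $U_\alpha$ are open and cover $X$, such that (i) $\phi_\alpha$ is a homeomorphism of $U_\alpha$ onto an open subset of $Y\times\mathbb{R}^k$ with $q_1\circ\phi_\alpha=p|_{U_\alpha}$; (ii) $\phi_\beta\circ\phi_\alpha^{-1}\in\mathrm{Diff}^0(\phi_\alpha(U_\alpha\cap U_\beta),\phi_\beta(U_\alpha\cap U_\beta))$ for all $\alpha,\beta$. Each $X^y$ is then a smooth manifold. Write $U\sim p(U)\times W$ for a chart $(U,\phi)$ with $\phi(U)=p(U)\times W$, $W\subset\mathbb{R}^k$ open. **Morphisms.** Let $(X_1,p_1),(X_2,p_2)$ be continuous families over $Y_1,Y_2$ and $q:Y_1\to Y_2$ continuous. A continuous $f:X_1\to X_2$ with $p_2\circ f=q\circ p_1$ is a morphism with respect to $q$ if each restriction $f^y:X_1^y\to X_2^{q(y)}$ is $C^\infty$ and, given $x\in X_1$ and a chart $U_2\sim p_2(U_2)\times W_2$ containing $f(x)$, there is a chart $U_1\sim p_1(U_1)\times W_1$ with $x\in U_1$, $f(U_1)\subset U_2$, such that, in local coordinates $f(y,w_1)=(q(y),f^y(w_1))$, the map $y\mapsto f^y$ is continuous from $p_1(U_1)$ into $C^\infty(W_1,W_2)$. When $Y_1=Y_2$ and no $q$ is mentioned, $q$ is the identity.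 Isomorphisms are morphisms with an inverse morphism. **Groupoids.** A groupoid is a small category with inverses. A locally compact groupoid is a groupoid $G$ that is a second countable locally compact Hausdorff space with continuous multiplication and inversion; $r(x)=xx^{-1}$, $s(x)=x^{-1}x$, $G^0=r(G)=s(G)$ is the unit space; $xy$ is defined iff $s(x)=r(y)$. A locally compact groupoid $G$ is a continuous family groupoid if: (i) $(G,s)$ and $(G,r)$ are continuous families of manifolds over $G^0$; (ii) inversion $i:(G,s)\to(G,r)$, $i(x)=x^{-1}$, is an isomorphism of continuous families over $G^0$; (iii) multiplication $m:(G*G,t_1)\to(G,r)$ is a morphism with respect to $r:G\to G^0$, where $G*G=\{(x,y)\in G\times G:s(x)=r(y)\}$, $t_1(x,y)=x$, and $(G*G,t_1)$ is the continuous family over $G$ with charts: for each chart $(U,\phi)$ of $(G,r)$, $\phi(y)=(r(y),h(y))$, the set $\{(x,y)\in G*G:y\in U\}$ with the map $(x,y)\mapsto(x,h(y))$. **$G$-spaces.** Let $G$ be a locally compact groupoid with $r,s$ open, and let $(Y,p)$ be a fiber space over $G^0$. Put $G*Y=\{(g,y)\in G\times Y:s(g)=p(y)\}$ with the relative topology. $(Y,p)$ is a $G$-space if there is given a continuous map (action) $G*Y\to Y$, $(g,y)\mapsto gy$, such that $p(gy)=r(g)$, $g_1(g_2y)=(g_1g_2)y$ and $g^{-1}(gy)=y$ whenever these make sense. **The groupoid $G*Y$.** For a $G$-space $Y$, $G*Y$ is a locally compact groupoid with operations $(h,z)(g,g^{-1}z)=(hg,g^{-1}z)$ and $(g,y)^{-1}=(g^{-1},gy)$;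 its unit space $\{(p(y),y):y\in Y\}$ is identified with $Y$, so its source and range maps are $s(g,y)=y$ and $r(g,y)=gy$. When $G$ is a continuous family groupoid, $(G*Y,s)$ is given the continuous family structure over $Y$ with charts: for each chart $(U,\phi)$ of $(G,s)$, $\phi(g)=(s(g),h(g))$, the set $\{(g,y)\in G*Y:g\in U\}$ with the map $(g,y)\mapsto(y,h(g))$. $(G*Y,r)$ is given the unique continuous family structure over $Y$ for which the inversion map $(G*Y,r)\to(G*Y,s)$ of $G*Y$ is an isomorphism of continuous families over $Y$.
   Formalization: Y is assumed second countable: G*Y must be second countable to be a locally compact groupoid and contains Y as its unit space, so the claim fails otherwise (e.g. the Lie group R^k acting trivially on an uncountable discrete Y). *)

(* Defs.v *)
From HB Require Import structures.
From mathcomp Require Import all_boot all_order all_algebra.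
From mathcomp Require Import all_classical all_reals all_analysis.
Import Order.TTheory GRing.Theory Num.Theory.
Import numFieldNormedType.Exports.

Set Implicit Arguments.
Unset Strict Implicit.
Unset Printing Implicit Defensive.

Local Open Scope classical_set_scope.
Local Open Scope ring_scope.

(* The field of real numbers is an arbitrary [R : realType].

   Maps with a domain of definition A are total functions whose values outside
   A are irrelevant: every notion below only looks at their values on A. *)

Section SmoothMaps.
Context {R : realType} {k : nat}.
Local Notation E := 'rV[R]_k.

Definition iter_pderive (s : seq 'I_k) (f : E -> E) : E -> E :=
  foldr (fun i h => 'D_(delta_mx 0 i) h) f s.

(* C^oo on the open set V: all iterated partial derivatives exist and are
   continuous on V. *)
Definition smooth_on (V : set E) (f : E -> E) : Prop :=
  forall s : seq 'I_k, forall x, V x ->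
    {for x, continuous (iter_pderive s f)} /\
    (forall i, derivable (iter_pderive s f) x (delta_mx 0 i)).

Definition compact_in (V K : set E) : Prop := compact K /\ K `<=` V.

(* Functions with the topology of uniform convergence, on the compact subsets
   of V, of all iterated partial derivatives; C^oo(V1, V2) has the topology it
   inherits as a subset of [jet_space V1] (functions that agree on V1 are
   topologically indistinguishable there). *)
Definition jet_space (V : set E) : Type := E -> E.

Definition jet (V : set E) (f : jet_space V) :
    prod_topology (fun _ : seq 'I_k => {family compact_in V, E -> E}) :=
  fun s => iter_pderive s f.

HB.instance Definition _ (V : set E) :=
  Topological.copy (jet_space V) (initial_topology (@jet V)).

Definition Cinfty (V1 V2 : set E) : set (jet_space V1) :=
  [set f : E -> E | smooth_on V1 f /\ f @` V1 `<=` V2].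

Definition continuous_into_Cinfty {Y : topologicalType} (U : set Y)
    (V1 V2 : set E) (F : Y -> E -> E) : Prop :=
  (forall y, U y -> @Cinfty V1 V2 (F y)) /\
  {within U, continuous (F : Y -> jet_space V1)}.

End SmoothMaps.

Section C0infty.
Context {R : realType} {k : nat} {Y : topologicalType}.
Local Notation E := 'rV[R]_k.

Definition fiber_preserving (A1 A2 : set (Y * E)) (f : Y * E -> Y * E) : Prop :=
  [/\ f @` A1 `<=` A2, {within A1, continuous f}
    & forall u, A1 u -> (f u).1 = u.1].

Definition C0infty (A1 A2 : set (Y * E)) (f : Y * E -> Y * E) : Prop :=
  [/\ open A1, open A2, fst @` A1 `<=` fst @` A2, fiber_preserving A1 A2 f
    & forall (U1 U2 : set Y) (V1 V2 : set E),
        open U1 -> open U2 -> open V1 -> open V2 ->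
        U1 `*` V1 `<=` A1 -> U2 `*` V2 `<=` A2 ->
        f @` (U1 `*` V1) `<=` U2 `*` V2 ->
        continuous_into_Cinfty U1 V1 V2 (fun y x => (f (y, x)).2)].

Definition Diff0 (A1 A2 : set (Y * E)) (f : Y * E -> Y * E) : Prop :=
  C0infty A1 A2 f /\
  exists g, [/\ C0infty A2 A1 g, (forall u, A1 u -> g (f u) = u)
              & (forall v, A2 v -> f (g v) = v)].

End C0infty.

Definition fiber_space {X Y : topologicalType} (p : X -> Y) : Prop :=
  [/\ locally_compact [set: X], hausdorff_space X,
      locally_compact [set: Y], hausdorff_space Y
    & [/\ continuous p, (forall U, open U -> open (p @` U))
        & range p = [set: Y]]].

Record chart (R : realType) (k : nat) (X Y : Type) := Chart {
  cdom : set X;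
  cmap : X -> Y * 'rV[R]_k }.

Section ContinuousFamilies.
Context {R : realType} {k : nat}.
Local Notation E := 'rV[R]_k.

Definition is_chart {X Y : topologicalType} (p : X -> Y)
    (c : chart R k X Y) : Prop :=
  [/\ open (cdom c), open (cmap c @` cdom c),
      {within cdom c, continuous (cmap c)},
      (exists psi : Y * E -> X,
         (forall x, cdom c x -> psi (cmap c x) = x) /\
         {within cmap c @` cdom c, continuous psi})
    & forall x, cdom c x -> (cmap c x).1 = p x].

(* [f] is the coordinate change from [c] to [d]; it is determined on
   [cmap c @` (cdom c `&` cdom d)] since [cmap c] is injective on [cdom c]. *)
Definition compatible {X Y : topologicalType} (c d : chart R k X Y) : Prop :=
  exists f : Y * E -> Y * E,
    (forall x, (cdom c `&` cdom d) x -> f (cmap c x) = cmap d x) /\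
    Diff0 (cmap c @` (cdom c `&` cdom d)) (cmap d @` (cdom c `&` cdom d)) f.

Definition is_atlas {X Y : topologicalType} (p : X -> Y)
    (A : set (chart R k X Y)) : Prop :=
  [/\ (forall c, A c -> is_chart p c),
      (forall x, exists2 c, A c & cdom c x)
    & (forall c d, A c -> A d -> compatible c d)].

Definition maximal_atlas {X Y : topologicalType} (p : X -> Y)
    (A : set (chart R k X Y)) : Prop :=
  is_atlas p A /\
  forall c, is_chart p c -> (forall d, A d -> compatible c d) -> A c.

Definition continuous_family {X Y : topologicalType} (p : X -> Y)
    (A : set (chart R k X Y)) : Prop :=
  fiber_space p /\ maximal_atlas p A.

(* The maximal atlas generated by the atlas [A]. *)
Definition gen_atlas {X Y : topologicalType} (p : X -> Y)
    (A : set (chart R k X Y)) : set (chart R k X Y) :=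
  [set c | is_chart p c /\ forall d, A d -> compatible c d].

(* [cdom c ~ p (cdom c) x W] *)
Definition product_chart {X Y : topologicalType} (p : X -> Y)
    (c : chart R k X Y) (W : set E) : Prop :=
  open W /\ cmap c @` cdom c = (p @` cdom c) `*` W.

(* Smoothness of the restriction of the continuous map [f] to the fiber over
   [y]: [F] is the expression of that restriction in the coordinates [c], [d]. *)
Definition fiber_smooth {X1 X2 Y1 Y2 : topologicalType} (p1 : X1 -> Y1)
    (A1 : set (chart R k X1 Y1)) (A2 : set (chart R k X2 Y2))
    (f : X1 -> X2) (y : Y1) : Prop :=
  forall c d, A1 c -> A2 d -> forall F : E -> E,
    let S := [set x | [/\ p1 x = y, cdom c x & cdom d (f x)]] in
    (forall x, S x -> F (cmap c x).2 = (cmap d (f x)).2) ->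
    smooth_on [set (cmap c x).2 | x in S] F.

Definition cf_morphism {X1 X2 Y1 Y2 : topologicalType} (p1 : X1 -> Y1)
    (A1 : set (chart R k X1 Y1)) (p2 : X2 -> Y2)
    (A2 : set (chart R k X2 Y2)) (q : Y1 -> Y2) (f : X1 -> X2) : Prop :=
  [/\ continuous q, continuous f, (forall x, p2 (f x) = q (p1 x)),
      (forall y, fiber_smooth p1 A1 A2 f y)
    & forall (x : X1) (c2 : chart R k X2 Y2) (W2 : set E),
        A2 c2 -> product_chart p2 c2 W2 -> cdom c2 (f x) ->
        exists (c1 : chart R k X1 Y1) (W1 : set E) (F : Y1 -> E -> E),
          [/\ A1 c1, product_chart p1 c1 W1, cdom c1 x,
              f @` cdom c1 `<=` cdom c2
            & (forall x', cdom c1 x' ->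
                 cmap c2 (f x') = (q (p1 x'), F (p1 x') (cmap c1 x').2)) /\
              continuous_into_Cinfty (p1 @` cdom c1) W1 W2 F]].

Definition cf_isomorphism {X1 X2 Y : topologicalType} (p1 : X1 -> Y)
    (A1 : set (chart R k X1 Y)) (p2 : X2 -> Y)
    (A2 : set (chart R k X2 Y)) (f : X1 -> X2) : Prop :=
  cf_morphism p1 A1 p2 A2 id f /\
  exists g, [/\ cancel f g, cancel g f & cf_morphism p2 A2 p1 A1 id g].

End ContinuousFamilies.

Definition fiber_prod {X Y Z : Type} (f : X -> Z) (g : Y -> Z) : set (X * Y) :=
  [set u | f u.1 = g u.2].

(* A small category with inverses: [G] is the set of arrows and [B] the set of
   objects, identified with a set of arrows through [gunit].  [gmul x y] is
   meaningful only when [gsrc x = grng y]. *)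
Record groupoid (G B : Type) := Groupoid {
  gsrc : G -> B;
  grng : G -> B;
  gunit : B -> G;
  gmul : G -> G -> G;
  ginv : G -> G;
  src_unit : forall b, gsrc (gunit b) = b;
  rng_unit : forall b, grng (gunit b) = b;
  src_mul : forall x y, gsrc x = grng y -> gsrc (gmul x y) = gsrc y;
  rng_mul : forall x y, gsrc x = grng y -> grng (gmul x y) = grng x;
  mul_assoc : forall x y z, gsrc x = grng y -> gsrc y = grng z ->
    gmul x (gmul y z) = gmul (gmul x y) z;
  mul_unitl : forall x, gmul (gunit (grng x)) x = x;
  mul_unitr : forall x, gmul x (gunit (gsrc x)) = x;
  src_inv : forall x, gsrc (ginv x) = grng x;
  rng_inv : forall x, grng (ginv x) = gsrc x;
  mul_invr : forall x, gmul x (ginv x) = gunit (grng x);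
  mul_invl : forall x, gmul (ginv x) x = gunit (gsrc x) }.

Definition composable {G B : Type} (g : groupoid G B) : set (G * G) :=
  fiber_prod (gsrc g) (grng g).

(* The last clause says that [gunit] is a homeomorphism of [B] onto the unit
   space, a subspace of [G]; it is injective by [src_unit]. *)
Definition lc_groupoid {G B : topologicalType} (g : groupoid G B) : Prop :=
  [/\ @second_countable G, locally_compact [set: G], hausdorff_space G,
      {within composable g, continuous (fun u => gmul g u.1 u.2)}
    & continuous (ginv g) /\
      (forall U : set B,
         open U <-> exists2 V : set G, open V & gunit g @^-1` V = U)].

(* The charts (x, y) |-> (x, h(y)) of (G*G, t1), for charts (grng, h) of
   (G, grng). *)
Definition mul_chart {R : realType} {k : nat} {G B : topologicalType}
    (g : groupoid G B) (c : chart R k G B) : chart R k (composable g) G :=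
  Chart [set u | cdom c (val u).2]
        (fun u => ((val u).1, (cmap c (val u).2).2)).

Definition mul_proj {G B : Type} (g : groupoid G B) (u : composable g) : G :=
  (val u).1.
Arguments mul_proj {G B} g u.

Definition mul_map {G B : Type} (g : groupoid G B) (u : composable g) : G :=
  gmul g (val u).1 (val u).2.
Arguments mul_map {G B} g u.

Definition mul_atlas {R : realType} {k : nat} {G B : topologicalType}
    (g : groupoid G B) (Ar : set (chart R k G B)) :
    set (chart R k (composable g) G) :=
  gen_atlas (mul_proj g) (mul_chart g @` Ar).
Arguments mul_atlas {R k G B} g Ar.

Definition cf_groupoid {R : realType} {k : nat} {G B : topologicalType}
    (g : groupoid G B) (As Ar : set (chart R k G B)) : Prop :=
  [/\ lc_groupoid g,
      continuous_family (gsrc g) As,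
      continuous_family (grng g) Ar,
      cf_isomorphism (gsrc g) As (grng g) Ar (ginv g)
    & cf_morphism (mul_proj g) (mul_atlas g Ar) (grng g) Ar
        (grng g) (mul_map g)].

Record gaction (G B Y : Type) (g : groupoid G B) (p : Y -> B) := GAction {
  act : G -> Y -> Y;
  act_proj : forall x y, gsrc g x = p y -> p (act x y) = grng g x;
  act_mul : forall x x' y, gsrc g x = grng g x' -> gsrc g x' = p y ->
    act x (act x' y) = act (gmul g x x') y;
  actK : forall x y, gsrc g x = p y -> act (ginv g x) (act x y) = y }.

Definition gspace {G B Y : topologicalType} (g : groupoid G B) (p : Y -> B)
    (a : gaction g p) : Prop :=
  fiber_space p /\
  {within fiber_prod (gsrc g) p, continuous (fun u => act a u.1 u.2)}.

Section ActionGroupoid.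
Context {G B Y : Type} {g : groupoid G B} {p : Y -> B}.
Variable a : gaction g p.

Definition act_dom : set (G * Y) := fiber_prod (gsrc g) p.

Lemma act_domP (u : act_dom) : gsrc g (val u).1 = p (val u).2.
Proof. by case: u => u /= /set_mem. Qed.

Definition act_pair x y (h : gsrc g x = p y) : act_dom :=
  exist (fun u => u \in act_dom) (x, y) (mem_set h).

Definition act_src (u : act_dom) : Y := (val u).2.

Definition act_rng (u : act_dom) : Y := act a (val u).1 (val u).2.

Definition act_unit (y : Y) : act_dom := act_pair (src_unit g (p y)).

Lemma act_inv_subproof (u : act_dom) :
  gsrc g (ginv g (val u).1) = p (act a (val u).1 (val u).2).
Proof. by rewrite src_inv act_proj// act_domP. Qed.

Definition act_inv (u : act_dom) : act_dom := act_pair (act_inv_subproof u).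

(* By [val_act_mul] the default value [u] is used only when the product is not
   defined. *)
Definition act_mul_op (u v : act_dom) : act_dom :=
  insubd u (gmul g (val u).1 (val v).1, (val v).2).

Lemma act_composable (u v : act_dom) : act_src u = act_rng v ->
  gsrc g (val u).1 = grng g (val v).1.
Proof. by move=> uv; rewrite act_domP -/(act_src u) uv act_proj// act_domP. Qed.

Lemma val_act_mul (u v : act_dom) : act_src u = act_rng v ->
  val (act_mul_op u v) = (gmul g (val u).1 (val v).1, (val v).2).
Proof.
move=> /act_composable uv; rewrite val_insubd ifT//; apply/mem_set.
by rewrite /act_dom /fiber_prod /= src_mul// act_domP.
Qed.

Lemma act_unitE b y : p y = b -> act a (gunit g b) y = y.
Proof.
move=> <-{b}; have e : gsrc g (gunit g (p y)) = p y by rewrite src_unit.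
have := actK a e; rewrite act_mul ?src_inv// mul_invl.
by rewrite src_unit.
Qed.

Lemma act_rng_mul (u v : act_dom) : act_src u = act_rng v ->
  act_rng (act_mul_op u v) = act_rng u.
Proof.
move=> uv; rewrite /act_rng val_act_mul//= -act_mul ?act_domP//.
- by rewrite -/(act_rng v) -uv.
- by rewrite -act_domP; exact: act_composable.
Qed.

Lemma act_src_mul (u v : act_dom) : act_src u = act_rng v ->
  act_src (act_mul_op u v) = act_src v.
Proof. by move=> uv; rewrite /act_src val_act_mul. Qed.

Program Definition act_groupoid : groupoid act_dom Y :=
  @Groupoid _ _ act_src act_rng act_unit act_mul_op act_inv
    _ _ act_src_mul act_rng_mul _ _ _ _ _ _ _.
Next Obligation. by []. Qed.
Next Obligation. by move=> y; exact: act_unitE. Qed.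
Next Obligation.
move=> u v w uv vw; apply: val_inj.
have uv_w : act_src (act_mul_op u v) = act_rng w by rewrite act_src_mul.
have u_vw : act_src u = act_rng (act_mul_op v w) by rewrite act_rng_mul.
by rewrite !val_act_mul//= mul_assoc//; exact: act_composable.
Qed.
Next Obligation.
move=> u; apply: val_inj; rewrite val_act_mul//=.
rewrite /act_rng act_proj ?act_domP// mul_unitl.
exact/esym/surjective_pairing.
Qed.
Next Obligation.
move=> u; apply: val_inj; rewrite val_act_mul//=; last first.
  by rewrite /act_rng /= act_unitE.
by rewrite /act_src -act_domP mul_unitr -surjective_pairing.
Qed.
Next Obligation. by []. Qed.
Next Obligation. by move=> u; rewrite /act_rng /= actK ?act_domP. Qed.
Next Obligation.
move=> u; apply: val_inj; rewrite val_act_mul//=.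
  by rewrite mul_invr /act_rng act_proj ?act_domP.
by rewrite /act_rng /= actK ?act_domP.
Qed.
Next Obligation.
move=> u; apply: val_inj; rewrite val_act_mul//=.
by rewrite mul_invl /act_src -act_domP.
Qed.

End ActionGroupoid.
Arguments act_dom {G B Y} g p.
Arguments act_src {G B Y} g p u.

(* The charts (x, y) |-> (y, h(x)) of (G*Y, gsrc), for charts (gsrc, h) of
   (G, gsrc). *)
Definition act_chart {R : realType} {k : nat} {G B Y : topologicalType}
    (g : groupoid G B) (p : Y -> B) (c : chart R k G B) :
    chart R k (act_dom g p) Y :=
  Chart [set u | cdom c (val u).1]
        (fun u => ((val u).2, (cmap c (val u).1).2)).
Arguments act_chart {R k G B Y} g p c.

Definition act_src_atlas {R : realType} {k : nat} {G B Y : topologicalType}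
    (g : groupoid G B) (p : Y -> B) (As : set (chart R k G B)) :
    set (chart R k (act_dom g p) Y) :=
  gen_atlas (act_src g p) (act_chart g p @` As).
Arguments act_src_atlas {R k G B Y} g p As.

(* [Ar] is a continuous family structure on (G*Y, grng) making the inversion
   (G*Y, grng) -> (G*Y, gsrc) an isomorphism of continuous families. *)
Definition act_rng_structure {R : realType} {k : nat} {G B Y : topologicalType}
    (g : groupoid G B) (p : Y -> B) (a : gaction g p)
    (As : set (chart R k G B))
    (Ar : set (chart R k (act_dom g p) Y)) : Prop :=
  continuous_family (grng (act_groupoid a)) Ar /\
  cf_isomorphism (grng (act_groupoid a)) Ar
    (gsrc (act_groupoid a)) (act_src_atlas g p As) (ginv (act_groupoid a)).

(* Main.v *)
Require Import Defs.
From HB Require Import structures.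
From mathcomp Require Import all_boot all_order all_algebra.
From mathcomp Require Import all_classical all_reals all_analysis.
Import Order.TTheory GRing.Theory Num.Theory.
Import numFieldNormedType.Exports.

(** The proof rests on three reductions.

    Joint smoothness.  For open [U] and [V], a map [y |-> F y] from [U] into
    the space of smooth maps on [V] is continuous if and only if all iterated
    partial derivatives of [F y] along the fibres exist and are continuous in
    both variables together ([continuous_into_CinftyP]).  Joint smoothness is a
    local property, and by the chain rule it is stable under composition
    ([jsmooth_comp]); the chain rule needs that continuous partial derivatives
    give differentiability ([partials_differentiable]).  Hence compatibility of
    charts is transitive, an atlas generates a maximal atlas
    ([maximal_gen_atlas]), and a map is a morphism of continuous families as
    soon as around each point its expression in one pair of charts is jointly
    smooth ([lsmooth_morphism], [morphism_lsmooth]).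

    Pullbacks.  If [X] is a continuous family over [B] and [q : Z -> B] is
    continuous, then the fibre product of [X] and [Z] over [B] is a continuous
    family over [Z]: in the pulled back charts the coordinate changes are those
    of [X], with parameter [q z] instead of [z] ([is_atlas_pull]).  For the same
    reason a map of fibre products that covers a smooth map is smooth
    ([lsmooth_pull]).

    The action groupoid.  The space [G*Y] is a pullback along [p : Y -> B] in two
    ways.  Over [Y] by the source it is the fibre product of [gsrc g] and [p];
    over [Y] by the range it is the fibre product of [grng g] and [p], because
    [(x, y)] is determined by [x] and [x y] ([is_pullback_act_rng]).  Give
    [(G*Y, r)] the atlas pulled back from [(G, r)].  The inversion of [G*Y]
    covers that of [G], so it is an isomorphism between the two families, and
    the multiplication of [G*Y] covers that of [G], so it is a morphism.  The
    atlas on [(G*Y, r)] is unique since for two such atlases the identity,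
    written as the square of the inversion, is smooth both ways. *)

Set Implicit Arguments.
Unset Strict Implicit.
Unset Printing Implicit Defensive.
Local Open Scope classical_set_scope.
Local Open Scope ring_scope.

(** * Differentiability from continuous partial derivatives *)

Lemma is_diff_eps (R : realType) (V W : normedModType R) (f : V -> W)
    (df : {linear V -> W}) (x : V) : continuous df ->
  (forall e : R, 0 < e ->
     \forall v \near (0 : V), `|f (v + x) - f x - df v| <= e * `|v|) ->
  is_diff x f df.
Proof.
move=> dfc fdf.
have fL : f \o shift x = cst (f x) + df +o_ (0 : V) id.
  apply/eqaddoP => _/posnumP[e]; near=> v.
  rewrite (_ : (_ - _) v = f (v + x) - f x - df v); first by near: v; exact: fdf.
  by rewrite -addrA -opprD.
have dL := diff_unique dfc fL.
by apply: DiffDef => //; apply/diff_locallyP; rewrite dL.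
Unshelve. all: by end_near. Qed.

Section PartialDerivatives.
Context {R : realType} {k : nat}.
Local Notation E := 'rV[R]_k.
Implicit Types (f : E -> R) (x z v : E).

Lemma is_derive_line f z v s : derivable f (z + s *: v) v ->
  is_derive s (1:R) (fun t : R => f (z + t *: v)) ('D_v f (z + s *: v)).
Proof.
move=> df; have e : (fun h => h^-1 *: (((fun t : R => f (z + t *: v)) \o
      shift s) (h *: (1:R)) - f (z + s *: v))) =
    (fun h => h^-1 *: ((f \o shift (z + s *: v)) (h *: v) - f (z + s *: v))).
  apply/funext => h /=; congr (_ *: (f _ - _)).
  by rewrite [h *: 1]mulr1 scalerDl addrCA.
by apply: DeriveDef; rewrite /derivable /derive e.
Qed.

Lemma mean_value_line f z v (t : R) :
  (forall s : R, `|s| <= `|t| -> derivable f (z + s *: v) v) ->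
  exists2 s : R, `|s| <= `|t| & f (z + t *: v) - f z = t * 'D_v f (z + s *: v).
Proof.
move=> df; pose g (s : R) : R := f (z + s *: v).
have dg (s : R) : `|s| <= `|t| -> is_derive s (1 : R) g ('D_v f (z + s *: v)).
  by move=> /df; exact: is_derive_line.
have cg (s : R) : `|s| <= `|t| -> {for s, continuous g}.
  move=> /dg dgs; apply/differentiable_continuous/derivable1_diffP.
  exact: ex_derive.
have g0 : g 0 = f z by rewrite /g scale0r addr0.
have inb (a b s : R) : s \in `[a, b] -> `|s| <= Num.max `|a| `|b|.
  rewrite in_itv/= le_max => /andP[??]; apply/orP.
  case: (lerP 0 s) => s0; [right|left].
    by rewrite ger0_norm// (le_trans _ (ler_norm _)).
  by rewrite ltr0_norm// ler_normr lerN2 orbC; apply/orP; left.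
have [t0|t0] := leP 0 t.
- have b s : s \in `[0, t] -> `|s| <= `|t|.
    by move=> /inb /le_trans; apply; rewrite normr0 ge_max lexx normr_ge0.
  have [||s sI] := @MVT_segment R g (fun s => 'D_v f (z + s *: v)) 0 t t0.
  + by move=> s sI; apply/dg/b/subset_itv_oo_cc.
  + by apply: continuous_in_subspaceT => s /set_mem/b/cg.
  by rewrite g0 subr0 mulrC => gs; exists s => //; exact: b.
- have b s : s \in `[t, 0] -> `|s| <= `|t|.
    by move=> /inb /le_trans; apply; rewrite normr0 ge_max lexx normr_ge0.
  have [||s sI] := @MVT_segment R g (fun s => 'D_v f (z + s *: v)) t 0 (ltW t0).
  + by move=> s sI; apply/dg/b/subset_itv_oo_cc.
  + by apply: continuous_in_subspaceT => s /set_mem/b/cg.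
  rewrite g0 sub0r mulrN mulrC => gs; exists s; first exact: b.
  by apply: oppr_inj; rewrite opprB.
Qed.

Definition linear_form (c : 'I_k -> R) v : R := \sum_i v 0 i * c i.

Lemma linear_form_is_linear c : linear (linear_form c).
Proof.
move=> a u v; rewrite /linear_form scaler_sumr -big_split /=.
by apply: eq_bigr => i _; rewrite !mxE mulrDl -mulrA.
Qed.

HB.instance Definition _ c :=
  GRing.isLinear.Build R E R _ (linear_form c) (linear_form_is_linear c).

Lemma linear_form_continuous c : continuous (linear_form c).
Proof.
apply: (@continuous_big _ _ _ _ xpredT (@add_continuous R)) => i _ v.
have vi : u 0 i @[u --> v] --> v 0 i by exact: (@coord_continuous R 1 k 0 i v).
by apply: (cvgM vi (cvg_cst (c i))).
Qed.

Definition trunc_row v (m : nat) : E := \row_j (if (j < m)%N then v 0 j else 0).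

Lemma trunc_row0 v : trunc_row v 0 = 0.
Proof. by apply/rowP => j; rewrite !mxE. Qed.

Lemma trunc_row_all v : trunc_row v k = v.
Proof. by apply/rowP => j; rewrite !mxE ltn_ord. Qed.

Lemma trunc_rowS v (i : 'I_k) : trunc_row v i.+1 = trunc_row v i + v 0 i *: delta_mx 0 i.
Proof.
apply/rowP => j; rewrite !mxE eqxx/= ltnS leq_eqVlt val_eqE.
have [->|ji] := eqVneq j i; first by rewrite ltnn mulr1 add0r.
by rewrite mulr0 addr0.
Qed.

Lemma norm_trunc_row_line v (i : 'I_k) (s : R) : `|s| <= `|v 0 i| ->
  `|trunc_row v i + s *: delta_mx 0 i : E| <= `|v|.
Proof.
move=> sv; have vj j : `|v 0 j| <= `|v|.
  by rewrite [leRHS]/Num.Def.normr/= mx_normrE; exact: (le_bigmax _ _ (ord0, j)).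
rewrite [leLHS]/Num.Def.normr/= mx_normrE (bigmax_le _ (normr_ge0 _))//= => -[a j] _.
rewrite !mxE/= ord1 eqxx /=; have [->|ji] := eqVneq j i.
  by rewrite ltnn mulr1 add0r (le_trans sv).
by rewrite mulr0 addr0; case: ifP => // _; rewrite normr0.
Qed.

(** The increment of [f] is a sum of increments along the coordinate axes, and
    the mean value theorem turns each of them into a partial derivative at a
    point close to [x]. *)
Lemma partials_differentiable f x :
  (forall i, \forall z \near x, derivable f z (delta_mx 0 i)) ->
  (forall i, {for x, continuous ('D_(delta_mx 0 i) f)}) ->
  is_diff x f (linear_form (fun i => 'D_(delta_mx 0 i) f x)).
Proof.
move=> df cf; set L := linear_form _.
apply: is_diff_eps => [|_/posnumP[e]]; first exact: linear_form_continuous.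
(* [k.+1] and not [k], which may be zero; the sum of [k] errors is below [e]. *)
pose e' := e%:num / k.+1%:R.
have near_i i : \forall z \near x, derivable f z (delta_mx 0 i) /\
    `|'D_(delta_mx 0 i) f x - 'D_(delta_mx 0 i) f z| < e'.
  apply: filterI; first exact: df.
  by have /cvgrPdist_lt := cf i; apply; rewrite /e' divr_gt0.
have [r /= r0 xr] : nbhs_ball x [set z | forall i, derivable f z (delta_mx 0 i) /\
    `|'D_(delta_mx 0 i) f x - 'D_(delta_mx 0 i) f z| < e'].
  by apply/nbhs_ballP; exact: (filter_forall _ near_i).
near=> v.
have vr : `|v| < r by near: v; exact: (@nbhs0_lt R E r r0).
have -> : f (v + x) - f x - L v = \sum_(i < k)
    (f (x + trunc_row v i.+1) - f (x + trunc_row v i) - v 0 i * 'D_(delta_mx 0 i) f x).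
  rewrite sumrB -(big_mkord xpredT
    (fun i => f (x + trunc_row v i.+1) - f (x + trunc_row v i))).
  by rewrite telescope_sumr// trunc_row0 trunc_row_all addr0 [v + x]addrC.
apply: (@le_trans _ _ (\sum_(i < k) e' * `|v|)); last first.
  rewrite sumr_const card_ord -mulr_natl mulrA ler_wpM2r//.
  by rewrite /e' mulrCA ler_piMr// ler_pdivrMr// mul1r ler_nat.
rewrite (le_trans (ler_norm_sum _ _ _))// ler_sum// => i _.
have ball_der (s : R) : `|s| <= `|v 0 i| ->
    derivable f (x + trunc_row v i + s *: delta_mx 0 i) (delta_mx 0 i) /\
    `|'D_(delta_mx 0 i) f x
      - 'D_(delta_mx 0 i) f (x + trunc_row v i + s *: delta_mx 0 i)| < e'.
  move=> /norm_trunc_row_line wv; rewrite -addrA; apply: xr.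
  by rewrite -ball_normE /= opprD addrA subrr sub0r normrN (le_lt_trans wv).
rewrite trunc_rowS addrA.
have [s sv ->] := @mean_value_line f (x + trunc_row v i) (delta_mx 0 i) (v 0 i)
  (fun s sv => (ball_der s sv).1).
rewrite -mulrBr normrM distrC mulrC; apply: ler_pM => //.
  exact/ltW/(ball_der s sv).2.
by rewrite [leRHS]/Num.Def.normr/= mx_normrE; exact: (le_bigmax _ _ (ord0, i)).
Unshelve. all: by end_near. Qed.

End PartialDerivatives.

(** * The chain rule for families of functions *)

Lemma is_derive_diff_comp (R : realType) (U V W : normedModType R)
    (F : U -> V) (h : V -> W) (x v : U) (dF : V) (dh : V -> W) :
  is_derive x v F dF -> is_diff (F x) h dh ->
  is_derive x v (h \o F) (dh dF).
Proof.
move=> [Fv <-] [hd <-].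
pose c (t : R) := F (t *: v + x).
have c0 : c 0 = F x by rewrite /c scale0r add0r.
have D1 (T : normedModType R) (f : U -> T) :
    'D_v f x = 'D_1 (fun t : R => f (t *: v + x)) (0 : R).
  rewrite /derive; set g1 := fun t => t^-1 *: _; set g2 := fun t => t^-1 *: _.
  suff -> : g1 = g2 by [].
  by rewrite funeqE /g1 /g2 => t /=; rewrite addr0 scale0r add0r [_%:A]mulr1.
have dc : differentiable c (0 : R).
  by have /derivable1_diffP := (derivable1P F x v).1 Fv.
rewrite -c0 in hd; have dhc := differentiable_comp dc hd.
apply: DeriveDef; first exact: ((derivable1P _ _ _).2 ((derivable1_diffP _ _).2 dhc)).
rewrite !D1 (deriveE _ dhc) (deriveE _ dc) (diff_comp dc hd) /=.
by rewrite c0.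
Qed.

Lemma slice_continuous (T U : topologicalType) (y : T) :
  continuous (fun x : U => (y, x)).
Proof.
move=> x P [[A B] /= [Ay Bx] AB]; apply: filterS Bx => z Bz.
by apply: AB; split => //=; exact: nbhs_singleton.
Qed.

Section FiberwiseDerivatives.
Context {R : realType} {k : nat}.
Local Notation E := 'rV[R]_k.

Definition fiber_pderive {Y : Type} {V : normedModType R} (i : 'I_k) (f : Y * E -> V)
    (u : Y * E) : V :=
  'D_(delta_mx 0 i) (fun x => f (u.1, x)) u.2.

(** Regularity of order [n] along the fibres, together with joint continuity.
    The recursion goes through the first partial derivatives, so that the
    Leibniz and chain rules can be iterated by induction on [n]. *)
Fixpoint smoothN {Y : topologicalType} {V : normedModType R} (n : nat)
    (A : set (Y * E)) (f : Y * E -> V) : Prop :=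
  (forall u, A u -> {for u, continuous f}) /\
  if n is m.+1 then
    (forall i u, A u -> derivable (fun x => f (u.1, x)) u.2 (delta_mx 0 i)) /\
    (forall i, smoothN m A (fiber_pderive i f))
  else True.

Section Closure.
Context {Y : topologicalType} (A : set (Y * E)).
Hypothesis oA : open A.

Lemma smoothN_continuous {V : normedModType R} n (f : Y * E -> V) :
  smoothN n A f -> forall u, A u -> {for u, continuous f}.
Proof. by case: n => [|n] []. Qed.

Lemma near_slice u : A u -> \forall x \near u.2, A (u.1, x).
Proof.
by case: u => y x Au; apply: (@slice_continuous _ _ y x); exact: open_nbhs_nbhs.
Qed.

Lemma smoothN_ext {V : normedModType R} n (f g : Y * E -> V) :
  (forall u, A u -> f u = g u) -> smoothN n A f -> smoothN n A g.
Proof.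
have cext (f1 g1 : Y * E -> V) : (forall u, A u -> f1 u = g1 u) ->
    (forall u, A u -> {for u, continuous f1}) ->
    forall u, A u -> {for u, continuous g1}.
  move=> fg cf u Au; have := cf u Au.
  rewrite /prop_for /continuous_at (fg _ Au); apply: cvg_trans; apply: near_eq_cvg.
  by near=> w; apply: fg; near: w; exact: (open_nbhs_nbhs (conj oA Au)).
have sext (f1 g1 : Y * E -> V) u : (forall u, A u -> f1 u = g1 u) -> A u ->
    {near u.2, (fun x => f1 (u.1, x)) =1 (fun x => g1 (u.1, x))}.
  by move=> fg Au; near=> x; apply: fg; near: x; exact: near_slice.
elim: n f g => [|n IH] f g fg /= [cf df]; split; try exact: cext cf.
  by [].
split=> [i u Au|i].
  exact/(near_eq_derivable (sext _ _ _ fg Au))/df.1.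
apply: IH (df.2 i) => u Au; exact/near_eq_derive/sext.
Unshelve. all: by end_near. Qed.

Lemma smoothNW {V : normedModType R} n (f : Y * E -> V) :
  smoothN n.+1 A f -> smoothN n A f.
Proof.
elim: n f => [|n IH] f [cf [df pf]]; first by [].
by split=> //; split=> // i; exact: IH (pf i).
Qed.

Lemma smoothN_cst {V : normedModType R} n (c : V) : smoothN n A (fun=> c).
Proof.
elim: n c => [|n IH] c; (split; first by move=> u _; exact: cvg_cst) => //.
split=> i; first by move=> u _; exact: derivable_cst.
by rewrite (_ : fiber_pderive i _ = fun=> 0)//; apply/funext => u; exact: derive_cst.
Qed.

Lemma smoothND n (f g : Y * E -> R) : smoothN n A f -> smoothN n A g ->
  smoothN n A (fun u => f u + g u).
Proof.
elim: n f g => [|n IH] f g [cf df] [cg dg]; (split; first by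
  move=> u Au; exact: cvgD (cf u Au) (cg u Au)) => //.
split=> i; first by move=> u Au; exact: derivableD (df.1 i u Au) (dg.1 i u Au).
apply: smoothN_ext (IH _ _ (df.2 i) (dg.2 i)) => u Au.
by rewrite /fiber_pderive -deriveD//; [exact: df.1|exact: dg.1].
Qed.

Lemma smoothN_sum n (I : Type) (r : seq I) (f : I -> Y * E -> R) :
  (forall i, smoothN n A (f i)) -> smoothN n A (fun u => \sum_(i <- r) f i u).
Proof.
move=> sf; elim: r => [|i r IH].
  by apply: smoothN_ext (smoothN_cst n 0) => u _; rewrite big_nil.
by apply: smoothN_ext (smoothND (sf i) IH) => u _; rewrite big_cons.
Qed.

Lemma smoothNM n (f g : Y * E -> R) : smoothN n A f -> smoothN n A g ->
  smoothN n A (fun u => f u * g u).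
Proof.
elim: n f g => [|n IH] f g sf sg; have [cf df] := sf; have [cg dg] := sg;
  (split; first by move=> u Au; exact: cvgM (cf u Au) (cg u Au)) => //.
split=> i; first by move=> u Au; exact: derivableM (df.1 i u Au) (dg.1 i u Au).
apply: smoothN_ext (smoothND (IH _ _ (smoothNW sf) (dg.2 i))
                             (IH _ _ (smoothNW sg) (df.2 i))) => -[y x] Au.
exact/esym/(deriveM (df.1 i _ Au) (dg.1 i _ Au)).
Qed.

Lemma continuous_coords (T : topologicalType) (F : T -> E) (u : T) :
  (forall j, {for u, continuous (fun u => F u 0 j)}) -> {for u, continuous F}.
Proof.
move=> cF; apply/cvgrPdist_le => /= e e0; near=> w.
rewrite [leLHS]/Num.Def.normr/= mx_normrE (bigmax_le _ (ltW e0))//= => -[a j] _.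
rewrite !mxE/= ord1; move: j; near: w; apply: filter_forall => j.
by have /cvgrPdist_le := cF j; exact.
Unshelve. all: by end_near. Qed.

End Closure.

(** By the chain rule a partial derivative of the composite is a sum of products
    of a partial derivative of [h], composed with [F], and a partial derivative
    of a coordinate of [F]; each factor is one step less regular, so the
    induction is on the order. *)
Lemma smoothN_comp {Y Z : topologicalType} (A : set (Y * E)) (C : set (Z * E))
    (q : Y -> Z) n (h : Z * E -> R) (F : Y * E -> E) :
  open A -> open C -> continuous q -> (forall u, A u -> C (q u.1, F u)) ->
  smoothN n C h -> (forall j, smoothN n A (fun u => F u 0 j)) ->
  smoothN n A (fun u => h (q u.1, F u)).
Proof.
move=> oA oC cq qA; elim: n h => [|n IH] h sh sF.
all: have cF u : A u -> {for u, continuous F} by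
  move=> Au; apply: continuous_coords => j; exact: smoothN_continuous (sF j) _ Au.
all: have cqF u : A u -> {for u, continuous (fun u => (q u.1, F u))} by
  move=> Au; apply: cvg_pair (cF u Au);
  exact: (continuous_comp (@cvg_fst _ _ (nbhs u.1) (nbhs u.2) _) (cq _)).
all: have ch u : A u -> {for u, continuous (fun u => h (q u.1, F u))} by
  move=> Au; apply: (continuous_comp (cqF u Au));
  exact: smoothN_continuous sh _ (qA _ Au).
  by split.
have [_ [dh ph]] := sh; split=> //.
have dF i u : A u -> is_derive u.2 (delta_mx 0 i) (fun x => h (q u.1, F (u.1, x)))
    (\sum_j fiber_pderive i (fun u => F u 0 j) u * fiber_pderive j h (q u.1, F u)).
  move=> Au; have uE : u = (u.1, u.2) by case: u {Au}.
  have dFu : derivable (fun x => F (u.1, x)) u.2 (delta_mx 0 i).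
    by apply/derivable_mxP => a j; rewrite ord1; exact: (sF j).2.1.
  have qAu := qA u Au.
  have hd : is_diff (F (u.1, u.2)) (fun z => h (q u.1, z))
      (linear_form (fun j => fiber_pderive j h (q u.1, F (u.1, u.2)))).
    apply: partials_differentiable => j; rewrite -uE.
      have := near_slice oC qAu; apply: filter_app; near=> z => /= Cz.
      exact: (dh j (q u.1, z)).
    exact: (continuous_comp (@slice_continuous _ _ (q u.1) (F u))
      (smoothN_continuous (ph j) qAu)).
  have /= := is_derive_diff_comp (derivableP dFu) hd.
  rewrite /linear_form (derive_mx dFu) -uE; congr (is_derive _ _ _ _).
  by apply: eq_bigr => j _; rewrite mxE.
split=> [i u Au|i]; first by have [] := dF i u Au.
have : smoothN n A (fun u => \sum_j fiber_pderive i (fun u => F u 0 j) u * fiber_pderive j h (q u.1, F u)).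
  apply: smoothN_sum => // j; apply: smoothNM => //; first exact: (sF j).2.2.
  by apply: IH (ph j) _ => l; exact: smoothNW.
by apply: smoothN_ext => // u Au; have [_ <-] := dF i u Au.
Unshelve. all: by end_near. Qed.

End FiberwiseDerivatives.

(** * Joint smoothness and the topology of smooth maps *)

Lemma base_continuous (T U V : topologicalType) (q : T -> U) :
  continuous q -> continuous (fun u : T * V => (q u.1, u.2)).
Proof.
move=> cq u; apply: cvg_pair (@cvg_snd _ _ (nbhs u.1) (nbhs u.2) _).
exact: (continuous_comp (@cvg_fst _ _ (nbhs u.1) (nbhs u.2) _) (cq _)).
Qed.

Section JointSmoothness.
Context {R : realType} {k : nat}.
Local Notation E := 'rV[R]_k.

(** The analytic content of the continuity of [y |-> F (y, _)] as a map into the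
    space of smooth maps, see [continuous_into_CinftyP]. *)
Definition jsmooth {Y : topologicalType} (A : set (Y * E)) (F : Y * E -> E) :=
  forall n, smoothN n A F.

(** The mean value theorem, hence the chain rule above, is about scalar
    functions; this transfers it to maps between fibres. *)
Lemma smoothN_coordP {Y : topologicalType} (A : set (Y * E)) n (F : Y * E -> E) :
  open A -> smoothN n A F <-> forall j, smoothN n A (fun u => F u 0 j).
Proof.
move=> oA; elim: n F => [|n IH] F.
  split=> [[cF _] j|sF]; split=> // u Au.
    exact: continuous_comp (cF u Au) (@coord_continuous _ _ _ _ _ _).
  by apply: continuous_coords => j; exact: (sF j).1.
have pdE i j u : derivable (fun x => F (u.1, x)) u.2 (delta_mx 0 i) ->
    fiber_pderive i F u 0 j = fiber_pderive i (fun u => F u 0 j) u.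
  by move=> dF; rewrite /fiber_pderive (derive_mx dF) mxE.
split=> [[cF [dF pF]] j|sF].
- have dFj i u : A u -> derivable (fun x => F (u.1, x) 0 j) u.2 (delta_mx 0 i).
    by move=> Au; have /derivable_mxP := dF i u Au; exact.
  split; first by move=> u Au;
    exact: continuous_comp (cF u Au) (@coord_continuous _ _ _ _ _ _).
  split=> // i; have /(IH _).1/(_ j) := pF i; apply: smoothN_ext => // u Au.
  exact/pdE/dF.
- have dF i u : A u -> derivable (fun x => F (u.1, x)) u.2 (delta_mx 0 i).
    move=> Au; apply/derivable_mxP => a j; rewrite ord1.
    exact: (sF j).2.1.
  split; first by move=> u Au; apply: continuous_coords => j; exact: (sF j).1.
  split=> // i; apply/IH => j; have := (sF j).2.2 i; apply: smoothN_ext => // u Au.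
  exact/esym/pdE/dF.
Qed.

Lemma jsmooth_comp {Y Z : topologicalType} (A : set (Y * E)) (C : set (Z * E))
    (q : Y -> Z) (H : Z * E -> E) (F : Y * E -> E) :
  open A -> open C -> continuous q -> (forall u, A u -> C (q u.1, F u)) ->
  jsmooth C H -> jsmooth A F -> jsmooth A (fun u => H (q u.1, F u)).
Proof.
move=> oA oC cq qA sH sF n; apply/smoothN_coordP => // j.
apply: (smoothN_comp (h := fun v => H v 0 j) oA oC cq qA).
  exact: (smoothN_coordP _ _ oC).1.
exact: (smoothN_coordP _ _ oA).1.
Qed.

(** A change of parameter commutes with the derivatives along the fibres; it
    needs no chain rule, only the continuity of [q]. *)
Lemma smoothN_base {Y Z : topologicalType} (A : set (Y * E)) (C : set (Z * E))
    (q : Y -> Z) n (H : Z * E -> E) :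
  continuous q -> (forall u, A u -> C (q u.1, u.2)) ->
  smoothN n C H -> smoothN n A (fun u => H (q u.1, u.2)).
Proof.
move=> cq qA; have cqA := @base_continuous _ _ E q cq.
elim: n H => [|n IH] H [cH sH]; (split; first by
  move=> u Au; exact: continuous_comp (cqA u) (cH _ (qA _ Au))) => //.
split=> [i u Au|i]; first exact: (sH.1 i _ (qA _ Au)).
exact: IH (sH.2 i).
Qed.

Lemma jsmooth_base {Y Z : topologicalType} (A : set (Y * E)) (C : set (Z * E))
    (q : Y -> Z) (H : Z * E -> E) :
  continuous q -> (forall u, A u -> C (q u.1, u.2)) ->
  jsmooth C H -> jsmooth A (fun u => H (q u.1, u.2)).
Proof. by move=> cq qA sH n; exact: smoothN_base cq qA (sH n). Qed.

Lemma smoothNS {Y : topologicalType} (A C : set (Y * E)) n (F : Y * E -> E) :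
  A `<=` C -> smoothN n C F -> smoothN n A F.
Proof.
move=> qA; elim: n F => [|n IH] F [cF sF]; (split; first by
  move=> u /qA; exact: cF) => //.
by split=> [i u /qA|i]; [exact: sF.1|exact: IH (sF.2 i)].
Qed.

Lemma jsmoothS {Y : topologicalType} (A C : set (Y * E)) (F : Y * E -> E) :
  A `<=` C -> jsmooth C F -> jsmooth A F.
Proof. by move=> qA sF n; exact: smoothNS (sF n). Qed.

Lemma smoothN_local {Y : topologicalType} (A : set (Y * E)) n (F : Y * E -> E) :
  (forall u, A u -> exists2 C, C u & smoothN n C F) -> smoothN n A F.
Proof.
elim: n F => [|n IH] F sF.
  by split=> // u /sF[C Cu [cF _]]; exact: cF.
split; first by move=> u /sF[C Cu [cF _]]; exact: cF.
split=> [i u /sF[C Cu [_ [dF _]]]|i]; first exact: dF.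
by apply: IH => u /sF[C Cu [_ [_ /(_ i)]]]; exists C.
Qed.

Lemma jsmooth_local {Y : topologicalType} (A : set (Y * E)) (F : Y * E -> E) :
  (forall u, A u -> exists C G, [/\ open C, C u, jsmooth C G
                                  & forall v, C v -> G v = F v]) ->
  jsmooth A F.
Proof.
move=> sF n; apply: smoothN_local => u /sF[C [G [oC Cu sG GF]]].
by exists C => //; apply: smoothN_ext (sG n).
Qed.

Lemma jsmooth_ext {Y : topologicalType} (A : set (Y * E)) (F G : Y * E -> E) :
  open A -> (forall u, A u -> F u = G u) -> jsmooth A F -> jsmooth A G.
Proof. by move=> oA FG sF n; apply: smoothN_ext (sF n). Qed.

Definition iter_fiber_pderive {Y : Type} (s : seq 'I_k) (F : Y * E -> E) (u : Y * E) : E :=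
  iter_pderive s (fun x => F (u.1, x)) u.2.

Lemma iter_fiber_pderive_rcons {Y : Type} s i (F : Y * E -> E) :
  iter_fiber_pderive (rcons s i) F = iter_fiber_pderive s (fiber_pderive i F).
Proof. by apply/funext => u; rewrite /iter_fiber_pderive /iter_pderive foldr_rcons. Qed.

(** The recursion of [smoothN] strips the innermost derivative, which is given by
    the last index of [s]; hence the decomposition of [s] as [rcons s i]. *)
Lemma smoothN_iterP {Y : topologicalType} (A : set (Y * E)) n (F : Y * E -> E) :
  smoothN n A F <->
  (forall s u, (size s <= n)%N -> A u -> {for u, continuous (iter_fiber_pderive s F)}) /\
  (forall s i u, (size s < n)%N -> A u ->
     derivable (iter_pderive s (fun x => F (u.1, x))) u.2 (delta_mx 0 i)).
Proof.
have F0 (G : Y * E -> E) : iter_fiber_pderive [::] G = G.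
  by apply/funext => -[].
elim: n F => [|n IH] F.
  split=> [[cF _]|[cF _]].
    split=> // s u; rewrite leqn0 => /nilP -> Au; rewrite F0; exact: cF.
  by split=> // u Au; have := cF [::] u isT Au; rewrite F0.
split=> [[cF [dF pF]]|[cF dF]].
  split=> [s u|s i u].
    case/lastP: s => [|s i]; first by move=> _; rewrite F0; exact: cF.
    by rewrite size_rcons ltnS iter_fiber_pderive_rcons; exact: ((IH _).1 (pF i)).1.
  case/lastP: s => [|s j]; first by move=> _; exact: dF.
  rewrite size_rcons ltnS => sn Au.
  by rewrite /iter_pderive foldr_rcons; exact: ((IH _).1 (pF j)).2.
split; first by move=> u Au; have := cF [::] u isT Au; rewrite F0.
split; first by move=> i u Au; exact: dF [::] i u isT Au.
move=> i; apply/IH; split=> [s u sn Au|s j u sn Au].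
  by rewrite -iter_fiber_pderive_rcons; apply: cF; rewrite ?size_rcons.
have := dF (rcons s i) j u; rewrite size_rcons ltnS sn => /(_ isT Au).
by rewrite /iter_pderive foldr_rcons.
Qed.

Lemma jsmoothP {Y : topologicalType} (A : set (Y * E)) (F : Y * E -> E) :
  jsmooth A F <-> forall s u, A u -> {for u, continuous (iter_fiber_pderive s F)} /\
    forall i, derivable (iter_pderive s (fun x => F (u.1, x))) u.2 (delta_mx 0 i).
Proof.
split=> [sF s u Au|sF n].
  have [_ dF] := (smoothN_iterP _ _ _).1 (sF (size s).+1).
  have [cF _] := (smoothN_iterP _ _ _).1 (sF (size s)).
  by split=> [|i]; [exact: cF|exact: dF].
by apply/smoothN_iterP; split=> [s u _ Au|s i u _ Au];
  [exact: (sF s u Au).1|exact: (sF s u Au).2].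
Qed.

End JointSmoothness.

Section Jets.
Context {R : realType} {k : nat}.
Local Notation E := 'rV[R]_k.

Lemma cvg_initial (S : choiceType) (T : topologicalType) (w : S -> T)
    (F : set_system S) (s : S) : Filter F ->
  w @ F --> w s -> F --> (s : initial_topology w).
Proof.
move=> FF ws U [?/= [[W oW <-]] /= Wws] /filterS; apply; apply: ws.
exact: open_nbhs_nbhs.
Qed.

(** The topology of [jet_space V] is an initial topology followed by a product
    and a supremum, so convergence is tested on each derivative and each compact
    set separately. *)
Lemma cvg_jetP (V : set E) (F : set_system (E -> E)) (f : E -> E) :
  Filter F ->
  F --> (f : jet_space V) <->
  forall s K, compact_in V K ->
    {uniform K, iter_pderive s @ F --> iter_pderive s f}.
Proof.
move=> FF; split=> [Ff s|Ff].
  apply/fam_cvgP.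
  have jF : @jet R k V @ F --> @jet R k V f.
    exact: (cvg_comp _ _ Ff (@initial_continuous _ _ (@jet R k V) f)).
  exact: (cvg_comp _ _ jF (@proj_continuous _ _ s _)).
apply: cvg_initial; apply/cvg_sup => s; apply: cvg_initial; apply/fam_cvgP => K.
exact: Ff.
Qed.

Lemma compact_nbhs_rV (V : set E) (x : E) : nbhs x V ->
  exists K : set E, [/\ compact K, nbhs x K & K `<=` V].
Proof.
move=> /nbhs_closedballP[e eV]; exists (closed_ball x e%:num); split => //.
  apply: bounded_closed_compact; last exact: closed_ball_closed.
  exists (`|x| + e%:num); split; first exact: num_real.
  move=> M xM z; rewrite closed_ballE// /closed_ball_/= => xz.
  rewrite (le_trans _ (ltW xM))// -(subrKC x z) (le_trans (ler_normD _ _))//.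
  by rewrite lerD2l distrC.
by apply/nbhs_closedballP; exists e.
Qed.

Lemma uniform_cvg_normP (K : set E) (F : set_system (E -> E)) (f : E -> E) :
  Filter F -> {uniform K, F --> f} <->
  forall e : R, 0 < e -> \forall h \near F, forall x, K x -> `|f x - h x| < e.
Proof.
move=> FF; split=> [Ff e e0|Ff P /uniform_nbhs[D [/= entD DP]]].
  apply: Ff; apply/uniform_nbhs; exists [set p | ball p.1 e p.2].
  split; first exact: entourage_ball (PosNum e0).
  by move=> h /= fh x /fh; rewrite -ball_normE.
move: entD; rewrite -entourage_ballE => -[e /= e0 eD].
have := Ff e e0; apply: filterS => h fh; apply: DP => x Kx; apply: eD => /=.
by rewrite -ball_normE; exact: fh.
Qed.

(** Uniform convergence on compact sets of continuous maps amounts to joint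
    continuity: one direction needs compact neighbourhoods in the fibre, the
    other is the tube lemma. *)
Lemma continuous_into_CinftyP {Y : topologicalType} (U : set Y)
    (V1 V2 : set E) (F : Y -> E -> E) : open U -> open V1 ->
  continuous_into_Cinfty U V1 V2 F <->
  jsmooth (U `*` V1) (fun u => F u.1 u.2) /\
  (forall y x, U y -> V1 x -> V2 (F y x)).
Proof.
move=> oU oV1; split=> [[sF cF]|[sF FV]].
- split; last by move=> y x Uy V1x; have [_] := sF y Uy; apply; exists x.
  apply/jsmoothP => s [y x] [/= Uy V1x]; split; last first.
    by move=> i; exact: ((sF y Uy).1 s x V1x).2.
  have cy : F @ y --> (F y : jet_space V1).
    by move: cF; rewrite (continuous_open_subspace _ oU) => /(_ y (mem_set Uy)).
  have [K [cK Kx KV]] := compact_nbhs_rV (open_nbhs_nbhs (conj oV1 V1x)).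
  have cs := (cvg_jetP V1 (F y) (fmap_filter F (nbhs_filter y))).1 cy s K (conj cK KV).
  apply/cvgrPdist_lt => e e0.
  have e2 : 0 < e / 2 by rewrite divr_gt0.
  have /= ny := (uniform_cvg_normP _ _ (fmap_filter _ (fmap_filter _ (nbhs_filter y)))).1 cs _ e2.
  have nx := ((sF y Uy).1 s x V1x).1.
  move/cvgrPdist_lt : nx => /(_ _ e2) nx.
  near=> z w => /=; rewrite /iter_fiber_pderive /=.
  rewrite -(subrKA (iter_pderive s (F y) w)) (splitr e).
  rewrite (le_lt_trans (ler_normD _ _))// ltrD//.
    by near: w.
  suff : forall x', K x' -> `|iter_pderive s (F y) x' - iter_pderive s (F z) x'| < e / 2.
    by apply; near: w.
  by near: z.
- have cs s y x : U y -> V1 x ->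
      {for (y, x), continuous (fun u => iter_pderive s (F u.1) u.2)}.
    by move=> Uy V1x; exact: ((jsmoothP _ _).1 sF s (y, x) (conj Uy V1x)).1.
  have cx s y x : U y -> V1 x -> {for x, continuous (iter_pderive s (F y))}.
    move=> Uy V1x; exact: (continuous_comp (@slice_continuous _ _ y x) (cs s y x Uy V1x)).
  split=> [y Uy|].
    split=> [s x V1x|_ [x V1x <-]]; last exact: FV.
    split; first exact: cx.
    by move=> i; exact: ((jsmoothP _ _).1 sF s (y, x) (conj Uy V1x)).2.
  rewrite (continuous_open_subspace _ oU) => y /set_mem Uy.
  apply/cvg_jetP => s K [cK KV]; apply/uniform_cvg_normP => e e0.
  have /compact_near_coveringP nc := cK.
  apply: (nc _ (nbhs y) (fun z x => `|iter_pderive s (F y) x - iter_pderive s (F z) x| < e)).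
  move=> x /KV V1x.
  have e2 : 0 < e / 2 by rewrite divr_gt0.
  have /cvgrPdist_lt/(_ _ e2)[[P Q] /= [Py Qx] PQ] := cs s y x Uy V1x.
  have /cvgrPdist_lt/(_ _ e2) nx := cx s y x Uy V1x.
  exists (Q `&` [set x' | `|iter_pderive s (F y) x - iter_pderive s (F y) x'| < e / 2], P).
    by split=> //; exact: filterI.
  move=> [x' z] [/= [Qx' xx'] Pz].
  rewrite -(subrKA (iter_pderive s (F y) x)) (splitr e).
  rewrite (le_lt_trans (ler_normD _ _))// ltrD//; first by rewrite distrC.
  exact: (PQ (z, x')).
Unshelve. all: by end_near. Qed.

End Jets.

(** * Maps of class C0infty and charts *)

Lemma open_box {Y Z : topologicalType} (A : set (Y * Z)) u : open A -> A u ->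
  exists U V, [/\ open U, open V, U u.1, V u.2 & U `*` V `<=` A].
Proof.
move=> oA Au; have /= [[P Q] /= [Pu Qu] PQ] : nbhs u A by exact: open_nbhs_nbhs.
move: Pu Qu; rewrite !nbhsE => -[U [oU Uu] UP] [V [oV Vu] VQ].
by exists U, V; split=> // v [Uv Vv]; apply: PQ; split; [exact: UP|exact: VQ].
Qed.

Lemma open_setX {Y Z : topologicalType} (U : set Y) (V : set Z) :
  open U -> open V -> open (U `*` V).
Proof.
move=> oU oV; rewrite openE => -[y z] [/= Uy Vz].
by exists (U, V) => //=; split; exact: open_nbhs_nbhs.
Qed.

Section C0inftyCriterion.
Context {R : realType} {k : nat} {Y : topologicalType}.
Local Notation E := 'rV[R]_k.

(** Boxes inside the open sets form a base, and [f] is continuous, so the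
    condition on all pairs of boxes amounts to a local condition on [A1]. *)
Lemma C0inftyP (A1 A2 : set (Y * E)) (f : Y * E -> Y * E) :
  open A1 -> open A2 -> fst @` A1 `<=` fst @` A2 ->
  C0infty A1 A2 f <->
  (forall u, A1 u -> A2 (f u) /\ (f u).1 = u.1) /\ jsmooth A1 (fun u => (f u).2).
Proof.
move=> oA1 oA2 A12; split=> [[_ _ _ [fA cf f1] sf]|[fA sf]].
- split; first by move=> u Au; split; [apply: fA; exists u|exact: f1].
  apply: jsmooth_local => u Au.
  have A2u : A2 (f u) by apply: fA; exists u.
  have [U2 [V2 [oU2 oV2 U2u V2u UV2]]] := open_box oA2 A2u.
  have cfu : {for u, continuous f}.
    by move: cf; rewrite (continuous_open_subspace _ oA1); apply; exact: mem_set.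
  have : nbhs u (A1 `&` f @^-1` (U2 `*` V2)).
    apply: filterI; first exact: open_nbhs_nbhs.
    by apply: cfu; apply: open_nbhs_nbhs; split; [exact: open_setX|].
  rewrite nbhsE => -[W [oW Wu] WA].
  have [U1 [V1 [oU1 oV1 U1u V1u UV1]]] := open_box oW Wu.
  have UVA := subset_trans UV1 WA.
  have /(continuous_into_CinftyP _ _ oU1 oV1)[sF _] := sf U1 U2 V1 V2 oU1 oU2 oV1 oV2
    (fun v UVv => (UVA v UVv).1) UV2
    (fun _ '(ex_intro2 v UVv e) => eq_ind _ (U2 `*` V2) (UVA v UVv).2 _ e).
  exists (U1 `*` V1), (fun u => (f (u.1, u.2)).2); split => //.
    exact: open_setX.
  by case.
- split=> //.
    split; first by move=> _ [u Au <-]; exact: (fA u Au).1.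
      rewrite (continuous_open_subspace _ oA1) => u /set_mem Au.
      have c2 : {for u, continuous (fun u => (f u).2)} := (sf 0).1 u Au.
      rewrite /prop_for /continuous_at.
      have -> : f u = (u.1, (f u).2) by rewrite -(fA u Au).2 -surjective_pairing.
      apply: (@cvg_trans _ ((v.1, (f v).2) @[v --> u])); last first.
        exact: (cvg_pair (@cvg_fst _ _ (nbhs u.1) (nbhs u.2) _) c2).
      apply: near_eq_cvg; have := open_nbhs_nbhs (conj oA1 Au); apply: filterS => v Av.
      by rewrite -(fA v Av).2 -surjective_pairing.
    by move=> u /fA[].
  move=> U1 U2 V1 V2 oU1 oU2 oV1 oV2 UV1 UV2 fUV.
  apply/continuous_into_CinftyP => //; split.
    apply: jsmooth_ext (jsmoothS UV1 sf); first exact: open_setX.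
    by case.
  by move=> y x Uy Vx; have [] := fUV (f (y, x)) (ex_intro2 _ _ (y, x) (conj Uy Vx) erefl).
Qed.

End C0inftyCriterion.

Section Charts.
Context {R : realType} {k : nat} {X Y : topologicalType}.
Local Notation E := 'rV[R]_k.
Variable p : X -> Y.
Implicit Types (c d e : chart R k X Y) (D : set X).

Lemma chart_open c : is_chart p c -> open (cdom c).
Proof. by case. Qed.

Lemma chart_fst c x : is_chart p c -> cdom c x -> (cmap c x).1 = p x.
Proof. by case=> _ _ _ _; exact. Qed.

Lemma chartE c x : is_chart p c -> cdom c x -> cmap c x = (p x, (cmap c x).2).
Proof. by move=> hc cx; rewrite -(chart_fst hc cx) -surjective_pairing. Qed.

Lemma chart_cvg c x : is_chart p c -> cdom c x -> {for x, continuous (cmap c)}.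
Proof.
move=> [oc _ cc _ _] cx.
by move: cc; rewrite (continuous_open_subspace _ oc); apply; exact: mem_set.
Qed.

Lemma chart_inj c x y : is_chart p c -> cdom c x -> cdom c y ->
  cmap c x = cmap c y -> x = y.
Proof. by move=> [_ _ _ [psi [psiK _]] _] cx cy e; rewrite -(psiK x cx) e psiK. Qed.

Lemma chart_open_image c D : is_chart p c -> open D -> D `<=` cdom c ->
  open (cmap c @` D).
Proof.
move=> [_ oA _ [psi [psiK cpsi]] _] oD Dc; rewrite openE => _ [x Dx <-].
have Ax : (cmap c @` cdom c) (cmap c x) by exists x => //; exact: Dc.
move: cpsi; rewrite (continuous_open_subspace _ oA) => /(_ _ (mem_set Ax)).
rewrite /prop_for /continuous_at (psiK _ (Dc _ Dx)) => cpsi.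
have nD := cpsi _ (open_nbhs_nbhs (conj oD Dx)).
apply: filterS2 (open_nbhs_nbhs (conj oA Ax)) nD => _ [z cz <-] /=.
by rewrite psiK// => Dz; exists z.
Qed.

(** The inverse of an injective open map is continuous on the image; the map [h]
    only provides values outside the image. *)
Lemma is_chartI c (h : Y -> X) : open (cdom c) ->
  (forall x, cdom c x -> {for x, continuous (cmap c)}) ->
  (forall x y, cdom c x -> cdom c y -> cmap c x = cmap c y -> x = y) ->
  (forall D, open D -> D `<=` cdom c -> open (cmap c @` D)) ->
  (forall x, cdom c x -> (cmap c x).1 = p x) -> is_chart p c.
Proof.
move=> oc cc ci co c1; split=> //; first exact: co.
  by rewrite (continuous_open_subspace _ oc) => x /set_mem; exact: cc.
have [|psi psiP] := @choice _ _
    (fun u x => (cmap c @` cdom c) u -> cdom c x /\ cmap c x = u).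
  move=> u; have [[x cx <-]|nu] := pselect ((cmap c @` cdom c) u).
    by exists x.
  by exists (h u.1).
have psiK x : cdom c x -> psi (cmap c x) = x.
  move=> cx; have [c1x e] := psiP _ (imageP (cmap c) cx); exact: ci.
exists psi; split=> //; rewrite (continuous_open_subspace _ (co _ oc (@subset_refl _ _))).
move=> _ /set_mem [x cx <-]; rewrite /continuous_at psiK// => P.
rewrite nbhsE => -[W [oW Wx] WP].
have oI : open (cmap c @` (W `&` cdom c)) by apply: co; [exact: openI|exact: subIsetr].
have Ix : (cmap c @` (W `&` cdom c)) (cmap c x) by exists x.
apply: filterS (open_nbhs_nbhs (conj oI Ix)) => _ [z [Wz cz] <-] /=.
by apply: WP; rewrite psiK.
Qed.

(** Joint smoothness of a map [phi] on [D], read in the chart [c]; the set [D]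
    is meant to be an open part of the domain of [c]. *)
Definition csmooth c D (phi : X -> E) : Prop :=
  exists F, jsmooth (cmap c @` D) F /\ forall x, D x -> F (cmap c x) = phi x.

Lemma csmoothS c D D' phi : D' `<=` D -> csmooth c D phi -> csmooth c D' phi.
Proof.
move=> DD [F [sF Fphi]]; exists F; split; last by move=> x /DD; exact: Fphi.
by apply: jsmoothS sF => _ [x Dx <-]; exists x => //; exact: DD.
Qed.

Lemma csmooth_ext c D phi phi' : (forall x, D x -> phi x = phi' x) ->
  csmooth c D phi -> csmooth c D phi'.
Proof.
by move=> e [F [sF Fphi]]; exists F; split=> // x Dx; rewrite Fphi// e.
Qed.

(** The local expressions glue because all of them agree with [phi] composed
    with the inverse of the chart. *)
Lemma csmooth_local c D phi : is_chart p c -> D `<=` cdom c ->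
  (forall x, D x -> exists D', [/\ open D', D' x, D' `<=` cdom c & csmooth c D' phi]) ->
  csmooth c D phi.
Proof.
move=> hc Dc sD; have [_ _ _ [psi [psiK _]] _] := hc.
exists (phi \o psi); split; last by move=> x /Dc cx /=; rewrite psiK.
apply: jsmooth_local => _ [x Dx <-]; have [D' [oD' D'x D'c [F [sF Fphi]]]] := sD x Dx.
exists (cmap c @` D'), F; split => //; first exact: chart_open_image.
by move=> _ [z D'z <-] /=; rewrite Fphi// psiK//; exact: D'c.
Qed.

End Charts.

(** * Compatible charts and maximal atlases *)

Section Composition.
Context {R : realType} {k : nat} {X1 X2 Y1 Y2 : topologicalType}.
Local Notation E := 'rV[R]_k.
Variables (p1 : X1 -> Y1) (p2 : X2 -> Y2) (q : Y1 -> Y2) (f : X1 -> X2).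

Lemma csmooth_comp (c : chart R k X1 Y1) (d : chart R k X2 Y2)
    (D1 : set X1) (D2 : set X2) (phi : X2 -> E) :
  is_chart p1 c -> is_chart p2 d -> open D1 -> open D2 ->
  D1 `<=` cdom c -> D2 `<=` cdom d -> (forall x, D1 x -> D2 (f x)) ->
  continuous q -> (forall x, p2 (f x) = q (p1 x)) ->
  csmooth c D1 (fun x => (cmap d (f x)).2) -> csmooth d D2 phi ->
  csmooth c D1 (phi \o f).
Proof.
move=> hc hd oD1 oD2 D1c D2d fD cq pq [F [sF Ff]] [H [sH Hphi]].
have qF x : D1 x -> (q (cmap c x).1, F (cmap c x)) = cmap d (f x).
  move=> Dx; rewrite Ff// (chart_fst hc (D1c _ Dx)) -pq (chartE hd)//.
  exact/D2d/fD.
exists (fun u => H (q u.1, F u)); split.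
  apply: (jsmooth_comp (chart_open_image hc oD1 D1c) (chart_open_image hd oD2 D2d) cq) => //.
  by move=> _ [x Dx <-]; rewrite qF//; exists (f x) => //; exact: fD.
by move=> x Dx; rewrite qF// Hphi//; exact: fD.
Qed.

End Composition.

Section Atlases.
Context {R : realType} {k : nat} {X Y : topologicalType}.
Local Notation E := 'rV[R]_k.
Variable p : X -> Y.
Implicit Types (c d e : chart R k X Y) (D : set X) (A : set (chart R k X Y)).

Lemma csmooth_change c d D phi : is_chart p c -> is_chart p d -> open D ->
  D `<=` cdom c -> D `<=` cdom d ->
  csmooth c D (fun x => (cmap d x).2) -> csmooth d D phi -> csmooth c D phi.
Proof.
move=> hc hd oD Dc Dd.
apply: (csmooth_comp (q := id) (f := id) hc hd oD oD Dc Dd) => // x; exact: cvg_id.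
Qed.

(** Coordinate changes preserve the first coordinate, so only their second
    component carries information. *)
Lemma compatibleP c d : is_chart p c -> is_chart p d ->
  compatible c d <-> csmooth c (cdom c `&` cdom d) (fun x => (cmap d x).2) /\
                     csmooth d (cdom c `&` cdom d) (fun x => (cmap c x).2).
Proof.
move=> hc hd; set D := cdom c `&` cdom d.
have oD : open D by apply: openI; [exact: chart_open hc|exact: chart_open hd].
have oc : open (cmap c @` D) by exact: (chart_open_image hc oD (@subIsetl _ _ _)).
have od : open (cmap d @` D) by exact: (chart_open_image hd oD (@subIsetr _ _ _)).
have fst_im c1 d1 : is_chart p c1 -> is_chart p d1 -> D `<=` cdom c1 -> D `<=` cdom d1 ->
    fst @` (cmap c1 @` D) `<=` fst @` (cmap d1 @` D).
  move=> h1 h2 D1 D2 _ [_ [x Dx <-] <-]; exists (cmap d1 x); first by exists x.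
  by rewrite (chart_fst h1 (D1 _ Dx)) (chart_fst h2 (D2 _ Dx)).
have cd : fst @` (cmap c @` D) `<=` fst @` (cmap d @` D).
  exact: (fst_im _ _ hc hd (@subIsetl _ _ _) (@subIsetr _ _ _)).
have dc : fst @` (cmap d @` D) `<=` fst @` (cmap c @` D).
  exact: (fst_im _ _ hd hc (@subIsetr _ _ _) (@subIsetl _ _ _)).
split=> [[f [fE [/(C0inftyP _ oc od cd)[fA sf] [h [/(C0inftyP _ od oc dc)[hA sh] hf fh]]]]]|].
  split; first by exists (fun u => (f u).2); split=> // x /fE ->.
  exists (fun u => (h u).2); split=> // x Dx.
  by rewrite -fE// hf//; exists x.
move=> [[F [sF Fd]] [H [sH Hc]]].
have Fe x : D x -> ((cmap c x).1, F (cmap c x)) = cmap d x.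
  by move=> Dx; rewrite Fd// (chart_fst hc Dx.1) (chartE hd Dx.2).
have He x : D x -> ((cmap d x).1, H (cmap d x)) = cmap c x.
  by move=> Dx; rewrite Hc// (chart_fst hd Dx.2) (chartE hc Dx.1).
exists (fun u => (u.1, F u)); split=> //; split.
  by apply/C0inftyP => //; split=> // _ [x Dx <-] /=; split=> //; exists x => //; rewrite Fe.
exists (fun u => (u.1, H u)); split.
- by apply/C0inftyP => //; split=> // _ [x Dx <-] /=; split=> //; exists x => //; rewrite He.
- by move=> _ [x Dx <-]; rewrite Fe// He.
- by move=> _ [x Dx <-]; rewrite He// Fe.
Qed.

Lemma compatible_csmooth c d D : is_chart p c -> is_chart p d -> compatible c d ->
  D `<=` cdom c -> D `<=` cdom d -> csmooth c D (fun x => (cmap d x).2).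
Proof.
move=> hc hd /(compatibleP hc hd)[cd _] Dc Dd.
by apply: csmoothS cd => x Dx; split; [exact: Dc|exact: Dd].
Qed.

Lemma compatible_sym c d : is_chart p c -> is_chart p d ->
  compatible c d -> compatible d c.
Proof.
by move=> hc hd /(compatibleP hc hd)[cd dc]; apply/(compatibleP hd hc); rewrite setIC.
Qed.

Lemma sub_gen_atlas A : is_atlas p A -> A `<=` gen_atlas p A.
Proof. by move=> [hA _ cA] c Ac; split; [exact: hA|move=> d; exact: cA]. Qed.

(** Compatibility with [A] is transitive since joint smoothness is local: near
    each point the coordinate change factors through a chart of [A]. *)
Lemma maximal_gen_atlas A : is_atlas p A -> maximal_atlas p (gen_atlas p A).
Proof.
move=> aA; have [hA covA cA] := aA; split; last first.
  by move=> c hc cc; split=> // d Ad; apply: cc; exact: (sub_gen_atlas aA).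
split=> [c []//|x|]; first by have [c Ac cx] := covA x; exists c => //; exact: (sub_gen_atlas aA).
have half c d : gen_atlas p A c -> gen_atlas p A d ->
    csmooth c (cdom c `&` cdom d) (fun x => (cmap d x).2).
  move=> [hc cc] [hd cd]; apply: (csmooth_local hc (@subIsetl _ _ _)) => x [cx dx].
  have [e Ae ex] := covA x; have he := hA _ Ae.
  have oD : open (cdom c `&` cdom d `&` cdom e).
    by apply: openI; [apply: openI|]; [exact: chart_open hc|exact: chart_open hd|exact: chart_open he].
  exists (cdom c `&` cdom d `&` cdom e); split=> //; first by move=> z [[]].
  apply: (csmooth_change hc he oD) => [z [[]]//|z []//||].
    by apply: (compatible_csmooth hc he (cc _ Ae)) => z; [case; case|case].
  apply: (compatible_csmooth he hd (compatible_sym hd he (cd _ Ae))) => z; first by case.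
  by case; case.
move=> c d gc gd; apply/(compatibleP gc.1 gd.1); split; first exact: half.
by rewrite setIC; exact: half.
Qed.

Definition restrict_chart c D : chart R k X Y := Chart D (cmap c).

Lemma is_chart_restrict c D : is_chart p c -> open D -> D `<=` cdom c ->
  is_chart p (restrict_chart c D).
Proof.
move=> hc oD Dc; have [_ _ _ [psi [psiK cpsi]] _] := hc; split => //=.
- exact: (chart_open_image hc).
- by rewrite (continuous_open_subspace _ oD) => x /set_mem/Dc; exact: (chart_cvg hc).
- exists psi; split=> [x /Dc|]; first exact: psiK.
  by apply: continuous_subspaceW cpsi => _ [x Dx <-]; exists x => //; exact: Dc.
- by move=> x /Dc; exact: (chart_fst hc).
Qed.

Lemma maximal_atlas_restrict A c D : maximal_atlas p A -> A c -> open D ->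
  D `<=` cdom c -> A (restrict_chart c D).
Proof.
move=> [[hA covA cA] maxA] Ac oD Dc; have hc := hA _ Ac.
have hr := is_chart_restrict hc oD Dc; apply: maxA => // d Ad.
have hd := hA _ Ad.
apply/(compatibleP hr hd); split.
  exact: (compatible_csmooth hc hd (cA _ _ Ac Ad) (subset_trans (@subIsetl _ _ _) Dc)).
apply: (compatible_csmooth hd hc (cA _ _ Ad Ac)); first exact: subIsetr.
exact: (subset_trans (@subIsetl _ _ _) Dc).
Qed.

(** Morphisms are defined with product charts; restricting a chart to the
    preimage of a box provides them. *)
Lemma product_chart_at A c D x : maximal_atlas p A -> A c -> open D ->
  D `<=` cdom c -> D x ->
  exists c' W, [/\ A c', product_chart p c' W, cdom c' x, cdom c' `<=` D
                 & cmap c' = cmap c].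
Proof.
move=> mA Ac oD Dc Dx; have hc : is_chart p c by case: mA => -[hA _ _] _; exact: hA.
have Dcx : (cmap c @` D) (cmap c x) by exists x.
have [U [W [oU oW Ux Wx UW]]] := open_box (chart_open_image hc oD Dc) Dcx.
pose D' := D `&` cmap c @^-1` (U `*` W).
have oD' : open D'.
  have -> : D' = \bigcup_(V in [set V | open V /\ V `<=` D']) V.
    apply/seteqP; split=> [z [Dz UWz]|z [V [_ VD'] Vz]]; last exact: VD'.
    have : nbhs z (D `&` cmap c @^-1` (U `*` W)).
      apply: filterI; first exact: open_nbhs_nbhs.
      apply: (chart_cvg hc (Dc _ Dz)); apply: open_nbhs_nbhs; split => //.
      exact: open_setX.
    by rewrite nbhsE => -[V [oV Vz] VD']; exists V.
  by apply: bigcup_open => V [].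
have D'c : D' `<=` cdom c by move=> z [/Dc].
have UE : p @` D' = U.
  apply/seteqP; split=> [_ [z [Dz [Uz _]] <-]|y Uy].
    by rewrite -(chart_fst hc (Dc _ Dz)).
  have [z Dz cz] := UW (y, (cmap c x).2) (conj Uy Wx).
  exists z; last by rewrite -(chart_fst hc (Dc _ Dz)) cz.
  by split=> //=; rewrite cz; split.
exists (restrict_chart c D'), W; split=> //=.
- exact: maximal_atlas_restrict.
- split=> //=; rewrite UE; apply/seteqP; split=> [_ [z [_ UWz] <-]//|u UWu].
  by have [z Dz cz] := UW u UWu; exists z => //; split=> //=; rewrite cz.
- exact: subIsetl.
Qed.

End Atlases.

(** * Morphisms of continuous families *)

(** Smoothness in some pair of charts around each point; by [lsmoothE] it then
    holds in all charts. *)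
Definition lsmooth {R : realType} {k : nat} {X1 X2 Y1 Y2 : topologicalType}
    (A1 : set (chart R k X1 Y1)) (A2 : set (chart R k X2 Y2)) (f : X1 -> X2) :=
  forall x, exists c d D, [/\ A1 c, A2 d, open D, D x &
    [/\ D `<=` cdom c, (forall z, D z -> cdom d (f z))
      & csmooth c D (fun z => (cmap d (f z)).2)]].

Lemma open_preimage {X Z : topologicalType} (f : X -> Z) (D : set Z) :
  continuous f -> open D -> open (f @^-1` D).
Proof. by move=> /continuousP; exact. Qed.

Section Morphisms.
Context {R : realType} {k : nat} {X1 X2 Y1 Y2 : topologicalType}.
Local Notation E := 'rV[R]_k.
Variables (p1 : X1 -> Y1) (p2 : X2 -> Y2) (q : Y1 -> Y2) (f : X1 -> X2).
Variables (A1 : set (chart R k X1 Y1)) (A2 : set (chart R k X2 Y2)).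
Hypotheses (cq : continuous q) (cf : continuous f)
  (pf : forall x, p2 (f x) = q (p1 x)).

(** Both changes of charts, in the source and in the target, are absorbed by
    composition; locality allows to work near one point. *)
Lemma lsmoothE (c : chart R k X1 Y1) (d : chart R k X2 Y2) :
  is_atlas p1 A1 -> is_atlas p2 A2 -> lsmooth A1 A2 f -> A1 c -> A2 d ->
  csmooth c (cdom c `&` f @^-1` cdom d) (fun x => (cmap d (f x)).2).
Proof.
move=> [hA1 _ cA1] [hA2 _ cA2] sf Ac Ad; have hc := hA1 _ Ac; have hd := hA2 _ Ad.
apply: (csmooth_local hc (@subIsetl _ _ _)) => x [cx dx].
have [c0 [d0 [D0 [Ac0 Ad0 oD0 D0x [D0c D0d s0]]]]] := sf x.
have hc0 := hA1 _ Ac0; have hd0 := hA2 _ Ad0.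
have oC : open (cdom d0 `&` cdom d).
  by apply: openI; [exact: chart_open hd0|exact: chart_open hd].
pose D := D0 `&` (cdom c `&` f @^-1` cdom d).
have oD : open D.
  apply: openI => //; apply: openI; first exact: chart_open hc.
  exact: open_preimage cf (chart_open hd).
have Dc : D `<=` cdom c by move=> z [_ []].
have Dc0 : D `<=` cdom c0 by move=> z [/D0c].
exists D; split => //.
apply: (csmooth_change hc hc0 oD Dc Dc0).
  exact: (compatible_csmooth hc hc0 (cA1 _ _ Ac Ac0)).
apply: (csmooth_comp (phi := fun x => (cmap d x).2) hc0 hd0 oD oC Dc0 (@subIsetl _ _ _) _ cq pf).
- by move=> z [/D0d d0z [_ dz]]; split.
- by apply: csmoothS s0; exact: subIsetl.
- apply: (compatible_csmooth hd0 hd (cA2 _ _ Ad0 Ad)); first exact: subIsetl.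
  exact: subIsetr.
Qed.

(** A single fibre is treated as a family with constant parameter [y], which
    makes the smoothness of a fibre a case of [jsmooth_base]. *)
Lemma csmooth_fiber_smooth c y (D : set X1) (phi : X1 -> E) (F : E -> E) :
  is_chart p1 c -> open D -> D `<=` cdom c -> csmooth c D phi ->
  let S := D `&` p1 @^-1` [set y] in
  (forall x, S x -> F (cmap c x).2 = phi x) ->
  smooth_on [set (cmap c x).2 | x in S] F.
Proof.
move=> hc oD Dc [G [sG Gphi]] S FS.
have oA := chart_open_image hc oD Dc.
pose A := [set u : Y1 * E | (cmap c @` D) (y, u.2)].
have oAy : open A.
  apply: (open_preimage (f := fun u : Y1 * E => (y, u.2))) oA.
  move=> u; exact: (continuous_comp (@cvg_snd _ _ (nbhs u.1) (nbhs u.2) _)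
    (@slice_continuous _ _ y u.2)).
have sF : jsmooth A (fun u => F u.2).
  have : jsmooth A (fun u => G (y, u.2)).
    by apply: (jsmooth_base (q := fun=> y)) sG => // u; exact: cvg_cst.
  apply: jsmooth_ext => // u [x Dx cx].
  have px : p1 x = y by rewrite -(chart_fst hc (Dc _ Dx)) cx.
  by rewrite -cx Gphi// -FS// cx.
move=> s _ [x [Dx px] <-].
have Ax : A (y, (cmap c x).2).
  by rewrite /A /=; exists x => //; rewrite (chartE hc (Dc _ Dx)) px.
have [cs ds] := (jsmoothP _ _).1 sF s _ Ax.
split=> //; exact: (continuous_comp (@slice_continuous _ _ y _) cs).
Qed.

Lemma lsmooth_morphism : maximal_atlas p1 A1 -> maximal_atlas p2 A2 ->
  lsmooth A1 A2 f -> cf_morphism p1 A1 p2 A2 q f.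
Proof.
move=> m1 m2 sf; have [hA1 covA1 _] := m1.1; have [hA2 _ _] := m2.1.
split=> // [y c d Ac Ad F S FS|x d W2 Ad [oW2 dW2] dx].
  have hc := hA1 _ Ac.
  have oD : open (cdom c `&` f @^-1` cdom d).
    apply: openI; first exact: chart_open hc.
    exact: open_preimage cf (chart_open (hA2 _ Ad)).
  have SE : S = (cdom c `&` f @^-1` cdom d) `&` p1 @^-1` [set y].
    by apply/seteqP; split=> z /=; [case|case=> -[]].
  rewrite SE; apply: (csmooth_fiber_smooth hc oD (@subIsetl _ _ _)
    (lsmoothE m1.1 m2.1 sf Ac Ad)) => z Sz.
  by apply: FS; rewrite SE.
have [c Ac cx] := covA1 x; have hc := hA1 _ Ac; have hd := hA2 _ Ad.
have oD : open (cdom c `&` f @^-1` cdom d).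
  by apply: openI; [exact: chart_open hc|exact: open_preimage cf (chart_open hd)].
have [c' [W1 [Ac' c'W c'x c'D c'c]]] :=
  product_chart_at m1 Ac oD (@subIsetl _ _ _) (conj cx dx).
have [F [sF Fd]] := csmoothS c'D (lsmoothE m1.1 m2.1 sf Ac Ad).
have [oW1 c'im] := c'W; have hc' := hA1 _ Ac'.
exists c', W1, (fun y w => F (y, w)); split=> //.
  by move=> _ [z /c'D[_ dz] <-].
have dF z : cdom c' z -> cmap d (f z) = (q (p1 z), F (p1 z, (cmap c' z).2)).
  move=> cz; have [_ dz] := c'D z cz.
  rewrite -(chartE hc' cz) c'c Fd// -pf; exact: (chartE hd dz).
split=> //; apply/continuous_into_CinftyP => //.
  move: (chart_open_image hc' (chart_open hc') (@subset_refl _ _)).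
  rewrite c'im => /fst_open; congr open; apply/seteqP.
  split=> [y [u [Uu _] <-]//|y Uy].
  exists (y, (cmap c' x).2) => //; split=> //=.
  have : (cmap c' @` cdom c') (cmap c' x) by exists x.
  by rewrite c'im => -[].
split.
  rewrite -c'im c'c; apply: jsmooth_ext sF; last by case.
  by apply: (chart_open_image hc) => //; [exact: chart_open hc'|
       exact: subset_trans c'D (@subIsetl _ _ _)].
move=> y w Uy Ww; have : (cmap c' @` cdom c') (y, w) by rewrite c'im.
move=> [z cz zyw]; have [_ dz] := c'D z cz.
have : (cmap d @` cdom d) (cmap d (f z)) by exists (f z).
by rewrite dW2 => -[_]; rewrite dF// -(chartE hc' cz) zyw.
Qed.

End Morphisms.

Section MoreMorphisms.
Context {R : realType} {k : nat}.
Local Notation E := 'rV[R]_k.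

Lemma morphism_lsmooth {X1 X2 Y1 Y2 : topologicalType}
    (p1 : X1 -> Y1) (p2 : X2 -> Y2) (q : Y1 -> Y2) (f : X1 -> X2)
    (A1 : set (chart R k X1 Y1)) (A2 : set (chart R k X2 Y2)) :
  is_atlas p1 A1 -> maximal_atlas p2 A2 ->
  cf_morphism p1 A1 p2 A2 q f -> lsmooth A1 A2 f.
Proof.
move=> [hA1 _ _] m2 [cq cf pf _ mf] x; have [hA2 covA2 _] := m2.1.
have [d Ad dx] := covA2 (f x).
have [d' [W2 [Ad' d'W d'x _ _]]] :=
  product_chart_at m2 Ad (chart_open (hA2 _ Ad)) (@subset_refl _ _) dx.
have [c [W1 [F [Ac [oW1 cW] cx cd [dF FC]]]]] := mf x d' W2 Ad' d'W d'x.
have hc := hA1 _ Ac; exists c, d', (cdom c); split=> //; first exact: chart_open hc.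
split=> //; first by move=> z cz; apply: cd; exists z.
exists (fun u => F u.1 u.2); split; last first.
  by move=> z cz; rewrite dF//= (chart_fst hc cz).
rewrite cW; apply: ((continuous_into_CinftyP _ _ _ _).1 FC).1 => //.
move: (chart_open_image hc (chart_open hc) (@subset_refl _ _)).
rewrite cW => /fst_open; congr open; apply/seteqP.
split=> [y [u [Uu _] <-]//|y Uy].
exists (y, (cmap c x).2) => //; split=> //=.
have : (cmap c @` cdom c) (cmap c x) by exists x.
by rewrite cW => -[].
Qed.

Lemma lsmooth_comp {X1 X2 X3 Y1 Y2 Y3 : topologicalType}
    (p1 : X1 -> Y1) (p2 : X2 -> Y2) (q : Y1 -> Y2) (f : X1 -> X2) (h : X2 -> X3)
    (A1 : set (chart R k X1 Y1)) (A2 : set (chart R k X2 Y2))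
    (A3 : set (chart R k X3 Y3)) :
  is_atlas p1 A1 -> is_atlas p2 A2 -> continuous q -> continuous f ->
  (forall x, p2 (f x) = q (p1 x)) ->
  lsmooth A1 A2 f -> lsmooth A2 A3 h -> lsmooth A1 A3 (h \o f).
Proof.
move=> a1 a2 cq cf pf sf sh x; have [hA1 covA1 _] := a1; have [hA2 _ _] := a2.
have [c Ac cx] := covA1 x; have hc := hA1 _ Ac.
have [d [e [C [Ad Ae oC Cfx [Cd Ce se]]]]] := sh (f x); have hd := hA2 _ Ad.
exists c, e, (cdom c `&` f @^-1` C); split=> //.
  by apply: openI; [exact: chart_open hc|exact: open_preimage cf oC].
split=> [z []//|z [_ /Ce]//|].
apply: (csmooth_comp (p1 := p1) (p2 := p2) (q := q) (D2 := C)
  (phi := fun z => (cmap e (h z)).2) hc hd) => //.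
- by apply: openI; [exact: chart_open hc|exact: open_preimage cf oC].
- by move=> z [].
- by apply: csmoothS (lsmoothE cq cf pf a1 a2 sf Ac Ad) => z [cz /Cd].
Qed.

Lemma lsmoothS {X1 X2 Y1 Y2 : topologicalType} (f : X1 -> X2)
    (A1 A1' : set (chart R k X1 Y1)) (A2 A2' : set (chart R k X2 Y2)) :
  A1 `<=` A1' -> A2 `<=` A2' -> lsmooth A1 A2 f -> lsmooth A1' A2' f.
Proof.
move=> s1 s2 sf x; have [c [d [D [Ac Ad oD Dx sD]]]] := sf x.
by exists c, d, D; split=> //; [exact: s1|exact: s2].
Qed.

(** Smoothness of the identity both ways says that the charts of one atlas are
    compatible with those of the other; maximality does the rest. *)
Lemma maximal_atlas_unique {X Y : topologicalType} (p : X -> Y)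
    (A A' : set (chart R k X Y)) : maximal_atlas p A -> maximal_atlas p A' ->
  lsmooth A A' id -> lsmooth A' A id -> A = A'.
Proof.
move=> m m' s s'; have cid (T : topologicalType) : continuous (@id T) by move=> x; exact: cvg_id.
have comp c d : A c -> A' d -> compatible c d.
  move=> Ac A'd; have [hA _ _] := m.1; have [hA' _ _] := m'.1.
  apply/(compatibleP (hA _ Ac) (hA' _ A'd)); split.
    exact: (lsmoothE (q := id) (cid _) (cid _) _ m.1 m'.1 s Ac A'd).
  rewrite setIC; exact: (lsmoothE (q := id) (cid _) (cid _) _ m'.1 m.1 s' A'd Ac).
apply/seteqP; split=> c Ac.
  have [hA _ _] := m.1; apply: m'.2; first exact: hA.
  by move=> d A'd; exact: comp.
have [hA' _ _] := m'.1; have [hA _ _] := m.1; apply: m.2; first exact: hA'.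
move=> d Ad; apply: (compatible_sym (hA _ Ad) (hA' _ Ac)); exact: comp.
Qed.

End MoreMorphisms.

(** * Pullbacks of continuous families *)

(** [P], with its maps [a] to [X] and [b] to [Z], is the topological fibre
    product of [pi : X -> B] and [q : Z -> B].  Neither an ambient product nor an
    inverse map is mentioned, because the same space is used as a fibre product
    in different ways. *)
Definition is_pullback {X B Z P : topologicalType} (pi : X -> B) (q : Z -> B)
    (a : P -> X) (b : P -> Z) : Prop :=
  [/\ continuous a, continuous b, (forall w, pi (a w) = q (b w)),
      (forall x z, pi x = q z -> exists2 w, a w = x & b w = z) &
      (forall w w', a w = a w' -> b w = b w' -> w = w') /\
      (forall w N, nbhs w N -> exists U V, [/\ nbhs (a w) U, nbhs (b w) V &
         forall w', U (a w') -> V (b w') -> N w'])].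

(** [act_chart] and [mul_chart] are both of this form, by conversion. *)
Definition pull_chart {R : realType} {k : nat} {X B Z P : Type}
    (a : P -> X) (b : P -> Z) (c : chart R k X B) : chart R k P Z :=
  Chart [set w | cdom c (a w)] (fun w => (b w, (cmap c (a w)).2)).

Section PulledAtlas.
Context {R : realType} {k : nat} {X B Z P : topologicalType}.
Local Notation E := 'rV[R]_k.
Variables (pi : X -> B) (q : Z -> B) (a : P -> X) (b : P -> Z).

(** Along a pullback the local expression of a map only has its parameter
    reparametrized by [q], so joint smoothness is preserved. *)
Lemma csmooth_pull (c : chart R k X B) D (phi : X -> E) :
  continuous q -> (forall w, pi (a w) = q (b w)) ->
  is_chart pi c -> D `<=` cdom c -> csmooth c D phi ->
  csmooth (pull_chart a b c) (a @^-1` D) (phi \o a).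
Proof.
move=> cq ab hc Dc [F [sF Fphi]].
have ce w : D (a w) -> (q (b w), (cmap c (a w)).2) = cmap c (a w).
  by move=> Dw; rewrite -ab -(chartE hc (Dc _ Dw)).
exists (fun u => F (q u.1, u.2)); split; last first.
  by move=> w Dw /=; rewrite ce// Fphi.
by apply: jsmooth_base sF => // _ [w Dw <-] /=; rewrite ce//; exists (a w).
Qed.

Hypotheses (cq : continuous q) (pb : is_pullback pi q a b)
  (pi_surj : range pi = [set: B]).

(** Surjectivity of [pi] gives a map from [Z] to [P], from which the inverse of
    the chart takes its values outside the image. *)
Lemma is_chart_pull c : is_chart pi c -> is_chart b (pull_chart (R := R) (k := k) a b c).
Proof.
move=> hc; have [ca cb ab lift [inj init]] := pb.
have /choice[h _] : forall z, exists w, b w = z.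
  move=> z; have : range pi (q z) by rewrite pi_surj.
  by move=> [x _ /lift[w _ bw]]; exists w.
apply: (is_chartI h) => //=.
- exact: (open_preimage ca (chart_open hc)).
- move=> w cw.
  have cc := continuous_comp (ca w) (chart_cvg hc cw).
  exact: (cvg_pair (cb w) (continuous_comp cc
    (@cvg_snd _ _ (nbhs (cmap c (a w)).1) (nbhs (cmap c (a w)).2) _))).
- move=> w w' cw cw' [bw cww]; apply: inj => //; apply: (chart_inj hc) => //.
  by rewrite (chartE hc cw) (chartE hc cw') !ab bw cww.
move=> D oD Dc; rewrite openE => _ [w Dw <-].
have [U [V [aU bV UVD]]] := init w D (open_nbhs_nbhs (conj oD Dw)).
have [U' [oU' U'w U'U]] : exists U', [/\ open U', U' (a w) & U' `<=` U `&` cdom c].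
  have : nbhs (a w) (U `&` cdom c).
    by apply: filterI => //; apply: open_nbhs_nbhs; split; [exact: chart_open hc|exact: Dc].
  by rewrite nbhsE => -[U' [oU' U'w] ?]; exists U'.
have oI : open (cmap c @` U') by apply: (chart_open_image hc oU') => z /U'U[].
have cI := @base_continuous _ _ E q cq (b w, (cmap c (a w)).2).
have Iw : nbhs (q (b w), (cmap c (a w)).2) (cmap c @` U').
  rewrite -ab -(chartE hc (Dc _ Dw)).
  exact: (open_nbhs_nbhs (conj oI (imageP (cmap c) U'w))).
have Vw : nbhs (b w, (cmap c (a w)).2) [set u | V u.1].
  exact: (@cvg_fst _ _ (nbhs (b w)) (nbhs (cmap c (a w)).2) _).
apply: filterS2 Vw (cI _ Iw) => -[z v] /= Vz [x U'x cx].
have [Ux cdx] := U'U x U'x.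
have pix : pi x = q z by rewrite -(chart_fst hc cdx) cx.
have [w' aw' bw'] := lift x z pix.
exists w'; last by rewrite aw' bw' cx.
by apply: UVD; rewrite ?aw' ?bw'.
Qed.

Lemma is_atlas_pull (A : set (chart R k X B)) :
  is_atlas pi A -> is_atlas b (pull_chart a b @` A).
Proof.
have [ca _ ab _ _] := pb; move=> [hA covA cA]; split.
- by move=> _ [c Ac <-]; exact/is_chart_pull/hA.
- by move=> w; have [c Ac cw] := covA (a w); exists (pull_chart a b c) => //; exists c.
move=> _ _ [c Ac <-] [d Ad <-].
have hc := hA _ Ac; have hd := hA _ Ad.
have half c1 d1 : A c1 -> A d1 -> csmooth (pull_chart a b c1)
    (a @^-1` (cdom c1 `&` cdom d1)) (fun w => (cmap (pull_chart a b d1) w).2).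
  move=> A1 A2; apply: (csmooth_pull (phi := fun x => (cmap d1 x).2) cq ab (hA _ A1)).
    exact: subIsetl.
  apply: (compatible_csmooth (hA _ A1) (hA _ A2) (cA _ _ A1 A2)); first exact: subIsetl.
  exact: subIsetr.
apply/(compatibleP (is_chart_pull hc) (is_chart_pull hd)); split; first exact: half.
have := half d c Ad Ac; rewrite setIC; exact.
Qed.

End PulledAtlas.

(** A map of pullbacks covering a smooth map is smooth, since its expression in
    pulled back charts is that of the map which it covers. *)
Lemma lsmooth_pull {R : realType} {k : nat} {X1 B1 Z1 P1 X2 B2 Z2 P2 : topologicalType}
    (pi1 : X1 -> B1) (q1 : Z1 -> B1) (a1 : P1 -> X1) (b1 : P1 -> Z1)
    (a2 : P2 -> X2) (b2 : P2 -> Z2)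
    (A1 : set (chart R k X1 B1)) (A2 : set (chart R k X2 B2))
    (f : X1 -> X2) (phi : P1 -> P2) :
  continuous q1 -> continuous a1 -> (forall w, pi1 (a1 w) = q1 (b1 w)) ->
  (forall c, A1 c -> is_chart pi1 c) -> (forall w, a2 (phi w) = f (a1 w)) ->
  lsmooth A1 A2 f ->
  lsmooth (pull_chart a1 b1 @` A1) (pull_chart a2 b2 @` A2) phi.
Proof.
move=> cq ca ab hA1 af sf w.
have [c [d [D [Ac Ad oD Dx [Dc Dd sD]]]]] := sf (a1 w).
exists (pull_chart a1 b1 c), (pull_chart a2 b2 d), (a1 @^-1` D); split=> //.
  exact: open_preimage.
split=> [z /Dc//|z /Dd|]; first by rewrite /= af.
apply: csmooth_ext (csmooth_pull cq ab (hA1 _ Ac) Dc sD) => z _ /=.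
by rewrite af.
Qed.

(** * Topology of fibre products *)

Section PullbackTopology.
Context {X B Z P : topologicalType}.
Variables (pi : X -> B) (q : Z -> B) (a : P -> X) (b : P -> Z).
Hypothesis pb : is_pullback pi q a b.

Lemma is_pullback_sym : is_pullback q pi b a.
Proof.
have [ca cb ab lift [inj init]] := pb; split=> // [z x zx|].
  by have [w aw bw] := lift x z (esym zx); exists w.
split=> [w w' bw aw|w N nN]; first exact: inj.
have [U [V [nU nV UV]]] := init w N nN.
by exists V, U; split=> // w' Vw Uw; exact: UV.
Qed.

Lemma pullback_open_map : continuous q -> (forall U, open U -> open (pi @` U)) ->
  forall U, open U -> open (b @` U).
Proof.
have [ca cb ab lift [inj init]] := pb.
move=> cq opi N oN; rewrite openE => _ [w Nw <-].
have [U [V [nU nV UV]]] := init w N (open_nbhs_nbhs (conj oN Nw)).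
move: nU; rewrite nbhsE => -[U' [oU' U'w] U'U].
have nq : nbhs (q (b w)) (pi @` U').
  rewrite -ab; exact: (open_nbhs_nbhs (conj (opi _ oU') (imageP pi U'w))).
apply: filterS2 nV (cq _ _ nq) => z Vz [x U'x xz].
have [w' aw' bw'] := lift x z xz.
by exists w' => //; apply: UV; [rewrite aw'; exact: U'U|rewrite bw'].
Qed.

Lemma pullback_surj : range pi = [set: B] -> range b = [set: Z].
Proof.
have [_ _ _ lift _] := pb; move=> spi; apply/seteqP; split=> // z _.
have : range pi (q z) by rewrite spi.
by move=> [x _ xz]; have [w _ bw] := lift x z xz; exists w.
Qed.

Lemma pullback_hausdorff :
  hausdorff_space X -> hausdorff_space Z -> hausdorff_space P.
Proof.
have [ca cb _ _ [inj _]] := pb; move=> hX hZ w w' ww'; apply: inj.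
- apply: hX => U V nU nV; have [z [Uz Vz]] := ww' _ _ (ca _ _ nU) (ca _ _ nV).
  by exists (a z).
- apply: hZ => U V nU nV; have [z [Uz Vz]] := ww' _ _ (cb _ _ nU) (cb _ _ nV).
  by exists (b z).
Qed.

Lemma pullback_second_countable :
  @second_countable X -> @second_countable Z -> @second_countable P.
Proof.
have [ca cb _ _ [_ init]] := pb.
move=> [BX cBX [oBX bBX]] [BZ cBZ [oBZ bBZ]].
exists ((fun UV => a @^-1` UV.1 `&` b @^-1` UV.2) @` (BX `*` BZ)).
  exact: sub_countable (card_image_le _ _) (countableX cBX cBZ).
split=> [_ [[U V] [/= BU BV] <-]|w N nN].
  by apply: openI; [exact: open_preimage ca (oBX _ BU)|exact: open_preimage cb (oBZ _ BV)].
have [U [V [nU nV UV]]] := init w N nN.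
have [U' [BU' U'w] U'U] := bBX _ _ nU; have [V' [BV' V'w] V'V] := bBZ _ _ nV.
exists (a @^-1` U' `&` b @^-1` V'); first by split=> //; exists (U', V').
by move=> z [U'z V'z]; apply: UV; [exact: U'U|exact: V'V].
Qed.

(** The fibre product of locally compact spaces over a Hausdorff base is closed
    in their product, hence locally compact. *)
Lemma pullback_locally_compact : continuous pi -> continuous q ->
  hausdorff_space B -> locally_compact [set: X] -> locally_compact [set: Z] ->
  locally_compact [set: P].
Proof.
have [ca cb ab lift [inj init]] := pb; move=> cpi cq hB lX lZ w _.
have [U nU [cU clU]] := lX (a w) I; have [V nV [cV clV]] := lZ (b w) I.
have {}nU : nbhs (a w) U by move: nU; rewrite /within/=; apply: filterS => x; exact.
have {}nV : nbhs (b w) V by move: nV; rewrite /within/=; apply: filterS => x; exact.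
exists (a @^-1` U `&` b @^-1` V).
  have : nbhs w (a @^-1` U `&` b @^-1` V) by apply: filterI; [exact: ca|exact: cb].
  by apply: filterS.
split; last by apply: closedI; exact: closed_comp.
move=> F PF FUV.
have [[x z] [[/= Ux Vz] Fxz]] := compact_setX cU cV
  (fmap_proper_filter (fun w => (a w, b w)) PF) FUV.
have xz : pi x = q z.
  apply: hB => M N nM nN.
  have nMN : nbhs (x, z) ((pi @^-1` M) `*` (q @^-1` N)).
    by exists (pi @^-1` M, q @^-1` N) => //=; split; [exact: cpi|exact: cq].
  have [[x' z'] [[w' _ [<- <-]] [/= Mx Nz]]] := Fxz (range (fun w => (a w, b w))) _
    (filterS (fun w _ => imageT (fun w => (a w, b w)) w) filterT) nMN.
  by exists (pi (a w')); split=> //; rewrite ab.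
have [w' aw' bw'] := lift x z xz; exists w'; split; first by rewrite /= aw' bw'.
move=> D N FD nN; have [M [L [nM nL ML]]] := init w' N nN.
have nML : nbhs (x, z) (M `*` L) by exists (M, L) => //=; rewrite -aw' -bw'.
have [[x' z'] [[v Dv [<- <-]] [/= Mv Lv]]] := Fxz ((fun w => (a w, b w)) @` D) _
  (filterS (fun w Dw => imageP (fun w => (a w, b w)) Dw) FD) nML.
by exists v; split=> //; exact: ML.
Qed.

Lemma pullback_fiber_space : fiber_space pi -> fiber_space q -> fiber_space b.
Proof.
move=> [lX hX lB hB [cpi opi spi]] [lZ hZ _ _ [cq _ _]]; have [_ cb _ _ _] := pb.
split=> //.
- exact: pullback_locally_compact.
- exact: pullback_hausdorff.
- by split=> //; [exact: pullback_open_map|exact: pullback_surj].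
Qed.

End PullbackTopology.

Lemma is_pullback_fiber_prod {X B Z : topologicalType} (pi : X -> B) (q : Z -> B) :
  is_pullback pi q (fun w : fiber_prod pi q => (val w).1) (fun w => (val w).2).
Proof.
have cval : continuous (val : fiber_prod pi q -> X * Z) by exact: initial_continuous.
split.
- move=> w; exact: (continuous_comp (cval w) (@cvg_fst _ _ _ _ _)).
- move=> w; exact: (continuous_comp (cval w) (@cvg_snd _ _ _ _ _)).
- by move=> [w /= /set_mem].
- by move=> x z xz; exists (exist (fun u => u \in fiber_prod pi q) (x, z) (mem_set xz)).
split=> [w w' e1 e2|w N].
  by apply: val_inj; rewrite [LHS]surjective_pairing e1 e2 -surjective_pairing.
move=> [_ [[W oW <-] Ww WN]].
have [U [V [oU oV Uw Vw UV]]] := open_box oW Ww.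
exists U, V; split; [exact: open_nbhs_nbhs|exact: open_nbhs_nbhs|].
by move=> w' Uw' Vw'; apply: WN; apply: UV.
Qed.

(** * The groupoid of an action *)

Lemma ginvK {G B : Type} (g : groupoid G B) : cancel (ginv g) (ginv g).
Proof.
move=> x; rewrite -[LHS](mul_unitl g) rng_inv src_inv -(mul_invr g x).
by rewrite -mul_assoc ?rng_inv ?src_inv// mul_invr rng_inv mul_unitr.
Qed.

Lemma lsmooth_sub {R : realType} {k : nat} {X1 X2 Y1 Y2 : topologicalType}
    (p1 : X1 -> Y1) (p2 : X2 -> Y2) (q : Y1 -> Y2) (f : X1 -> X2)
    (A A1 : set (chart R k X1 Y1)) (A2 : set (chart R k X2 Y2)) :
  continuous q -> continuous f -> (forall x, p2 (f x) = q (p1 x)) ->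
  is_atlas p1 A1 -> is_atlas p2 A2 -> is_atlas p1 A -> A `<=` A1 ->
  lsmooth A1 A2 f -> lsmooth A A2 f.
Proof.
move=> cq cf pf a1 a2 [hA covA _] AA1 sf x.
have [c Ac cx] := covA x; have [hA2 covA2 _] := a2; have [d Ad dx] := covA2 (f x).
exists c, d, (cdom c `&` f @^-1` cdom d); split=> //.
  apply: openI; first exact: chart_open (hA _ Ac).
  exact: open_preimage cf (chart_open (hA2 _ Ad)).
split=> [z []//|z []//|]; exact: (lsmoothE cq cf pf a1 a2 sf (AA1 _ Ac) Ad).
Qed.

Lemma gen_pull_lsmooth {R : realType} {k : nat}
    {X1 B1 Z1 P1 X2 B2 Z2 P2 : topologicalType}
    (pi1 : X1 -> B1) (q1 : Z1 -> B1) (a1 : P1 -> X1) (b1 : P1 -> Z1)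
    (pi2 : X2 -> B2) (q2 : Z2 -> B2) (a2 : P2 -> X2) (b2 : P2 -> Z2)
    (A1 : set (chart R k X1 B1)) (A2 : set (chart R k X2 B2))
    (f : X1 -> X2) (phi : P1 -> P2) :
  continuous q1 -> is_pullback pi1 q1 a1 b1 -> range pi1 = [set: B1] ->
  continuous q2 -> is_pullback pi2 q2 a2 b2 -> range pi2 = [set: B2] ->
  is_atlas pi1 A1 -> is_atlas pi2 A2 ->
  (forall w, a2 (phi w) = f (a1 w)) -> lsmooth A1 A2 f ->
  lsmooth (gen_atlas b1 (pull_chart a1 b1 @` A1))
          (gen_atlas b2 (pull_chart a2 b2 @` A2)) phi.
Proof.
move=> cq1 pb1 s1 cq2 pb2 s2 at1 at2 af sf.
have [ca1 _ ab1 _ _] := pb1; have [hA1 _ _] := at1.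
apply: lsmoothS (sub_gen_atlas (is_atlas_pull cq1 pb1 s1 at1))
  (sub_gen_atlas (is_atlas_pull cq2 pb2 s2 at2)) _.
exact: (lsmooth_pull b2 cq1 ca1 ab1 hA1 af sf).
Qed.

Lemma continuous_into_sub {T X : topologicalType} (A : set X) (f : T -> A) :
  continuous (fun t => val (f t)) -> continuous f.
Proof. exact: continuous_comp_initial. Qed.

Lemma continuous_val {X : topologicalType} (A : set X) :
  continuous (val : A -> X).
Proof. exact: initial_continuous. Qed.

Lemma continuous_pair {T U V : topologicalType} (f : T -> U) (h : T -> V) :
  continuous f -> continuous h -> continuous (fun t => (f t, h t)).
Proof. by move=> cf ch t; exact: (cvg_pair (cf t) (ch t)). Qed.

Lemma continuous_of {T U V : topologicalType} (f : T -> U) (h : U -> V) :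
  continuous f -> continuous h -> continuous (fun t => h (f t)).
Proof. by move=> cf ch t; exact: continuous_comp (cf t) (ch (f t)). Qed.

Lemma continuous_within_of {T U V : topologicalType} (A : set U) (f : U -> V)
    (h : T -> U) : {within A, continuous f} -> continuous h ->
  (forall t, A (h t)) -> continuous (fun t => f (h t)).
Proof.
move=> /subspace_sigL_continuousP cf ch Ah.
pose h' t : A := exist (fun u => u \in A) (h t) (mem_set (Ah t)).
have ch' : continuous h' by exact: continuous_into_sub.
exact: (continuous_of ch' cf).
Qed.

Lemma composableP {G B : Type} (g : groupoid G B) (u : composable g) :
  gsrc g (val u).1 = grng g (val u).2.
Proof. by case: u => u h; exact: (set_mem h). Qed.

Section ActionGroupoid.
Context {R : realType} {k : nat} {G B Y : topologicalType}.
Variables (g : groupoid G B) (As Ar : set (chart R k G B)) (p : Y -> B)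
  (a : gaction g p).
Hypotheses (gG : cf_groupoid g As Ar) (gY : gspace a) (sY : @second_countable Y).

Local Notation H := (act_dom g p).
Local Notation ga := (act_groupoid a).

Let arrow (w : H) : G := (val w).1.

Let lcG : lc_groupoid g. Proof. by case: gG. Qed.
Let fs : fiber_space (gsrc g). Proof. by case: gG => _ []. Qed.
Let fr : fiber_space (grng g). Proof. by case: gG => _ _ []. Qed.
Let mS : maximal_atlas (gsrc g) As. Proof. by case: gG => _ []. Qed.
Let mR : maximal_atlas (grng g) Ar. Proof. by case: gG => _ _ []. Qed.
Let fY : fiber_space p. Proof. by case: gY. Qed.

Let ci : continuous (ginv g). Proof. by case: lcG => _ _ _ _ []. Qed.
Let cp : continuous p. Proof. by case: fY => _ _ _ _ []. Qed.
Let cs : continuous (gsrc g). Proof. by case: fs => _ _ _ _ []. Qed.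
Let cr : continuous (grng g). Proof. by case: fr => _ _ _ _ []. Qed.
Let surj_s : range (gsrc g) = [set: B]. Proof. by case: fs => _ _ _ _ []. Qed.
Let surj_r : range (grng g) = [set: B]. Proof. by case: fr => _ _ _ _ []. Qed.

Lemma unit_continuous : continuous (gunit g).
Proof.
by apply/continuousP => V oV; have [_ _ _ _ [_ ->]] := lcG; exists V.
Qed.

Lemma arrow_continuous : continuous arrow.
Proof. by have [] := @is_pullback_fiber_prod _ _ _ (gsrc g) p. Qed.

Lemma act_src_continuous : continuous (act_src g p).
Proof. by have [] := @is_pullback_fiber_prod _ _ _ (gsrc g) p. Qed.

Lemma act_rng_continuous : continuous (act_rng a).
Proof.
have [_ ca] := gY.
exact: (continuous_within_of ca (@continuous_val _ H) (@act_domP _ _ _ _ _)).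
Qed.

Lemma act_inv_continuous : continuous (act_inv a).
Proof.
apply: continuous_into_sub; apply: continuous_pair act_rng_continuous.
exact: continuous_of arrow_continuous ci.
Qed.

Lemma is_pullback_act_src : is_pullback (gsrc g) p arrow (act_src g p).
Proof. exact: is_pullback_fiber_prod. Qed.

(** In the coordinates [(x, x y)] the space of the groupoid is the fibre product
    of [grng g] and [p]. *)
Lemma is_pullback_act_rng : is_pullback (grng g) p arrow (act_rng a).
Proof.
have [_ _ _ lift [inj init]] := is_pullback_act_src.
have invK : cancel (act_inv a) (act_inv a) := ginvK ga; split.
- exact: arrow_continuous.
- exact: act_rng_continuous.
- by move=> w; rewrite /act_rng act_proj// act_domP.
- move=> x z xz; have [|w aw bw] := lift (ginv g x) z; first by rewrite src_inv.
  exists (act_inv a w); first by rewrite /arrow /= -/(arrow w) aw ginvK.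
  by rewrite -bw; exact: (rng_inv ga w).
split=> [w w' aw bw|w N nN].
  have : act_inv a w = act_inv a w'.
    by apply: inj; rewrite /arrow /=; [congr ginv|].
  by move/(congr1 (act_inv a)); rewrite !invK.
have nI : nbhs (act_inv a w) (act_inv a @^-1` N).
  by apply: act_inv_continuous; rewrite (invK w).
have [U [V [nU nV UV]]] := init _ _ nI.
exists (ginv g @^-1` U), V; split=> //; first exact: ci.
by move=> w' Uw' Vw'; rewrite -(invK w'); exact: UV.
Qed.

Let BS : set (chart R k H Y) := act_src_atlas g p As.
(** Pulling back the charts of [(G, r)] is more convenient than transporting
    those of [(G*Y, s)] by the inversion: it makes every structure map of [G*Y] a
    map of pullbacks. *)
Definition act_rng_atlas : set (chart R k H Y) :=
  gen_atlas (act_rng a) (pull_chart arrow (act_rng a) @` Ar).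
Let BR := act_rng_atlas.

Let mBS : maximal_atlas (act_src g p) BS.
Proof. exact/maximal_gen_atlas/(is_atlas_pull cp is_pullback_act_src surj_s mS.1). Qed.

Let mBR : maximal_atlas (act_rng a) BR.
Proof. exact/maximal_gen_atlas/(is_atlas_pull cp is_pullback_act_rng surj_r mR.1). Qed.

(** The inverse morphism of an isomorphism given by [ginv g] is [ginv g] itself,
    since inversion is an involution. *)
Lemma ginv_lsmooth : lsmooth As Ar (ginv g) /\ lsmooth Ar As (ginv g).
Proof.
have [_ _ _ [mi [h [ih hi mh]]] _] := gG; split.
  exact: morphism_lsmooth mS.1 mR mi.
have <- : h = ginv g by apply/funext => x; rewrite -{1}(ginvK g x) ih.
exact: morphism_lsmooth mR.1 mS mh.
Qed.

Lemma act_inv_lsmooth : lsmooth BS BR (act_inv a) /\ lsmooth BR BS (act_inv a).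
Proof.
have [sSR sRS] := ginv_lsmooth; split.
  exact: (gen_pull_lsmooth cp is_pullback_act_src surj_s cp is_pullback_act_rng
    surj_r mS.1 mR.1 _ sSR).
exact: (gen_pull_lsmooth cp is_pullback_act_rng surj_r cp is_pullback_act_src
  surj_s mR.1 mS.1 _ sRS).
Qed.

Let id_cont : continuous (@id Y). Proof. by move=> y; exact: cvg_id. Qed.

Lemma act_family_src : continuous_family (gsrc ga) BS.
Proof. by split; [exact: (pullback_fiber_space is_pullback_act_src)|]. Qed.

Lemma act_family_rng : continuous_family (grng ga) BR.
Proof. by split; [exact: (pullback_fiber_space is_pullback_act_rng)|]. Qed.

Lemma act_inv_iso_src : cf_isomorphism (gsrc ga) BS (grng ga) BR (ginv ga).
Proof.
have [sSR sRS] := act_inv_lsmooth; have cI := act_inv_continuous.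
split; first exact: (lsmooth_morphism id_cont cI (rng_inv ga) mBS mBR sSR).
exists (ginv ga); split; [exact: ginvK|exact: ginvK|].
exact: (lsmooth_morphism id_cont cI (src_inv ga) mBR mBS sRS).
Qed.

Lemma act_inv_iso_rng : cf_isomorphism (grng ga) BR (gsrc ga) BS (ginv ga).
Proof.
have [mi [h [ih hi mh]]] := act_inv_iso_src.
have hE : h = ginv ga by apply/funext => x; rewrite -{1}(ginvK ga x) ih.
by split; [rewrite -hE|exists (ginv ga); split; [exact: ginvK|exact: ginvK|]].
Qed.

(** The identity from one structure to another is the inversion into
    [(G*Y, s)] followed by the inversion out of it. *)
Lemma act_rng_structure_unique : unique (act_rng_structure a As) BR.
Proof.
split; first by split; [exact: act_family_rng|exact: act_inv_iso_rng].
move=> B' [[_ mB'] [mi [h [ih hi mh]]]].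
have hE : h = ginv ga by apply/funext => x; rewrite -{1}(ginvK ga x) ih.
have [sSR sRS] := act_inv_lsmooth; have cI := act_inv_continuous.
have s1 := morphism_lsmooth mB'.1 mBS mi.
have s2 := morphism_lsmooth mBS.1 mB' mh; rewrite hE in s2.
have idE : ginv ga \o ginv ga = id by apply/funext => w; exact: ginvK.
apply: (maximal_atlas_unique mBR mB').
  have := lsmooth_comp mBR.1 mBS.1 id_cont cI (src_inv ga) sRS s2.
  by rewrite idE.
have := lsmooth_comp mB'.1 mBS.1 id_cont cI (src_inv ga) s1 sSR.
by rewrite idE.
Qed.

Lemma act_lc_groupoid : lc_groupoid ga.
Proof.
have [sG lG hG cm _] := lcG; have [lH hH _ _ _] := act_family_src.1.
split=> //.
- exact: (pullback_second_countable is_pullback_act_src).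
- apply/subspace_sigL_continuousP; apply: continuous_into_sub.
  pose u1 (u : composable ga) := (val u).1; pose u2 (u : composable ga) := (val u).2.
  have cu : continuous (val : composable ga -> H * H) by exact: continuous_val.
  have cu1 : continuous u1 by exact: (continuous_of cu (fun u => @cvg_fst _ _ _ _ _)).
  have cu2 : continuous u2 by exact: (continuous_of cu (fun u => @cvg_snd _ _ _ _ _)).
  have comp u : act_src g p (u1 u) = act_rng a (u2 u) := composableP u.
  have -> : (fun u => val (sigL (composable ga) (fun u => gmul ga u.1 u.2) u)) =
      (fun u => (gmul g (arrow (u1 u)) (arrow (u2 u)), act_src g p (u2 u))).
    by apply/funext => u; exact: (val_act_mul (comp u)).
  apply: continuous_pair; last exact: continuous_of cu2 act_src_continuous.
  apply: (continuous_within_of (h := fun u => (arrow (u1 u), arrow (u2 u))) cm).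
    by apply: continuous_pair;
      [exact: continuous_of cu1 arrow_continuous|exact: continuous_of cu2 arrow_continuous].
  by move=> u; exact: act_composable (comp u).
split; first exact: act_inv_continuous.
move=> U; split=> [oU|[V oV <-]].
  by exists (act_src g p @^-1` U) => //; exact: open_preimage act_src_continuous oU.
apply: open_preimage oV; apply: continuous_into_sub.
apply: continuous_pair; last by move=> y; exact: cvg_id.
exact: continuous_of cp unit_continuous.
Qed.

Lemma mul_pullback {G' B' : topologicalType} (g' : groupoid G' B') :
  is_pullback (grng g') (gsrc g') (fun u : composable g' => (val u).2) (mul_proj g').
Proof. exact/is_pullback_sym/is_pullback_fiber_prod. Qed.

Lemma mul_map_continuous {G' B' : topologicalType} (g' : groupoid G' B') :
  lc_groupoid g' -> continuous (mul_map g').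
Proof. by move=> [_ _ _ /subspace_sigL_continuousP cm _]. Qed.

(** The product of two arrows of [G*Y] is computed on their components in [G],
    so multiplication covers the multiplication of [g] along the map [th]; and a
    chart of [(G, r)], pulled back to [(G*Y, r)] and then to composable pairs, is
    also the pullback along [th] of the corresponding chart on composable pairs
    of [g]. *)
Lemma act_mul_morphism :
  cf_morphism (mul_proj ga) (mul_atlas ga BR) (grng ga) BR (grng ga) (mul_map ga).
Proof.
have [_ _ _ _ mm] := gG.
have ag := is_atlas_pull cs (mul_pullback g) surj_r mR.1.
have surj_ga : range (grng ga) = [set: Y] by have [[_ _ _ _ []]] := act_family_rng.
have aga := is_atlas_pull (q := gsrc ga) act_src_continuous (mul_pullback ga) surj_ga mBR.1.
apply: lsmooth_morphism => //.
- exact: act_rng_continuous.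
- exact: mul_map_continuous act_lc_groupoid.
- by move=> u; exact/rng_mul/composableP.
- exact: maximal_gen_atlas.
have sg : lsmooth (mul_chart g @` Ar) Ar (mul_map g).
  apply: (lsmooth_sub (q := grng g) cr (mul_map_continuous lcG) _
    (maximal_gen_atlas ag).1 mR.1 ag (sub_gen_atlas ag)).
    by move=> u; exact/rng_mul/composableP.
  exact: (morphism_lsmooth (maximal_gen_atlas ag).1 mR mm).
have comp (u : composable ga) :
    composable g (arrow (val u).1, arrow (val u).2).
  exact: act_composable (composableP u).
pose th (u : composable ga) : composable g :=
  exist (fun v => v \in composable g) _ (mem_set (comp u)).
have cth : continuous th.
  apply: continuous_into_sub.
  have cu : continuous (val : composable ga -> H * H) by exact: continuous_val.
  by apply: continuous_pair; apply: continuous_of arrow_continuous;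
    [exact: (continuous_of cu (fun u => @cvg_fst _ _ _ _ _))|
     exact: (continuous_of cu (fun u => @cvg_snd _ _ _ _ _))].
have [hag _ _] := ag.
apply: lsmoothS (lsmooth_pull (a2 := arrow) (b1 := mul_proj ga) (act_rng a)
  arrow_continuous cth (fun=> erefl) hag _ sg).
- move=> _ [_ [c Ac <-] <-]; apply: (sub_gen_atlas aga).
  exists (pull_chart arrow (act_rng a) c) => //.
  apply: (sub_gen_atlas (is_atlas_pull cp is_pullback_act_rng surj_r mR.1)).
  by exists c.
- exact: (sub_gen_atlas (is_atlas_pull cp is_pullback_act_rng surj_r mR.1)).
- move=> u; exact: (congr1 fst (val_act_mul (composableP u))).
Qed.

End ActionGroupoid.

Theorem proposition5 (R : realType) (k : nat) (G B Y : topologicalType)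
    (g : groupoid G B) (As Ar : set (chart R k G B))
    (p : Y -> B) (a : gaction g p) :
  (0 < k)%N ->
  cf_groupoid g As Ar ->
  gspace a ->
  @second_countable Y ->
  exists Br : set (chart R k (act_dom g p) Y),
    unique (act_rng_structure a As) Br /\
    cf_groupoid (act_groupoid a) (act_src_atlas g p As) Br.
Proof.
move=> _ gG gY sY; exists (act_rng_atlas Ar a); split.
  exact: act_rng_structure_unique.
split.
- exact: act_lc_groupoid gG gY sY.
- exact: act_family_src gG gY.
- exact: act_family_rng gG gY.
- exact: act_inv_iso_src gG gY.
- exact: act_mul_morphism gG gY sY.
Qed.
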